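(* Let $M$ be a matroid with lattice of flats $\mathcal L(M)$ and rank function $\rho$, and let $k$ be a field. For each flat $F$ of $M$ the standard module $\Delta_{F,k}=\Delta_F\otimes_{\mathbb Z}k$ is naturally non-negatively graded and its graded dimension is $$\sum_{G\supseteq F}\mu^+(F,G)\,t^{\rho(G)-\rho(F)}=(-t)^{\rho(M_F)}\,p(M_F;-t^{-1}),$$ where the sum runs over all flats $G$ containing $F$. The graded dimension of $S_k(M)$ is therefore $$\sum_{F\in\mathcal L(M)}p(M_F;-t)\,p(M_F;-t^{-1}),$$ where the sum runs over all flats $F$ of $M$.
   Context: $M$ is a matroid on a finite ground set $E$ with lattice of flats $\mathcal L=\mathcal L(M)$ ordered by inclusion and rank function $\rho$. For flats write $K\lessdot L$ (or $L\gtrdot K$) if $L$ covers $K$. A flag path is a finite nonempty sequence $(K_1,\dots,K_l)$ of flats with $K_i\lessdot K_{i+1}$ or $K_i\gtrdot K_{i+1}$ for each $i<l$ (commas may be replaced by these symbols). The free $\mathbb Z$-module on flag paths is an algebra under concatenation: $(K_1,\dots,K_l)\cdot(L_1,\dots,L_{l'})=(K_1,\dots,K_l=L_1,L_2,\dots,L_{l'})$ if $K_l=L_1$ and $0$ otherwise. $S(M)$ is its quotient by the two-sided ideal generated by: (FS) for flats $L<K$ with $\rho(K)=\rho(L)+2$: $\sum_X(L\lessdot X\lessdot K)=0=\sum_X(K\gtrdot X\gtrdot L)$, sums over flats $X$ with $K\gtrdot X\gtrdot L$; ($\bigwedge$) for $K\lessdot L$ and $K'\lessdot L$: $(K\lessdot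 L\gtrdot K')$ equals $|L\setminus K|\,(K)$ if $K=K'$; $-(K\gtrdot K\cap K'\lessdot K')$ if $K\ne K'$ and $K\cap K'\lessdot K$; and $0$ otherwise. $S_k(M)=S(M)\otimes_{\mathbb Z}k$. $S(M)$ is $\mathbb Z$-graded with $(K\gtrdot L)$ in degree $1$ and $(L\lessdot K)$ in degree $-1$ (and $(K)$ in degree $0$). Standard module: $\Delta_F$ is the left module $S(M)\cdot(F)$ modulo the $\mathbb Z$-span of the images of all flag paths that end at $F$ and pass through some flat not containing $F$. It is spanned over $\mathbb Z$ by classes of flags $(K_m\gtrdot\dots\gtrdot K_1\gtrdot F)$, and the natural grading puts such a flag in degree $m$. $\mu$ is the Möbius function of the lattice $\mathcal L$ and $\mu^+(F,G)=(-1)^{\rho(G)-\rho(F)}\mu(F,G)$. $M_F$ is the contraction of $M$ by $F$ (ground set $E\setminus F$, flats $G\setminus F$ for flats $G\supseteq F$), of rank $\rho(M_F)=\rho(E)-\rho(F)$, and its characteristic polynomial is $p(M_F;t)=\sum_{G\supseteq F}\mu(F,G)\,t^{\rho(E)-\rho(G)}$. The graded dimension of a graded vector space $X=\bigoplus_i X_i$ is $\sum_i\dim(X_i)t^i$. *)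

(* Defs.v *)
From HB Require Import structures.
From mathcomp Require Import all_boot all_order all_algebra.
From mathcomp Require Import generic_quotient ring_quotient fraction.
From mathcomp Require Import finmap.
From mathcomp Require Import boolp.
From mathcomp Require Import monalg.

Set Implicit Arguments.
Unset Strict Implicit.
Unset Printing Implicit Defensive.

Import Order.TTheory GRing.Theory Num.Theory.
Local Open Scope ring_scope.
Local Open Scope quotient_scope.

(* Linear extension of a function on the basis of a free module. *)
Section LinearExtension.
Variables (K : choiceType) (R : comNzRingType) (V : lmodType R).
Implicit Types (h : K -> V) (a : {malg R[K]}).

Definition linext h a : V := \sum_(p <- msupp a) a@_p *: h p.

Lemma linextw h a (d : {fset K}) :
  (msupp a `<=` d)%fset -> linext h a = \sum_(p <- d) a@_p *: h p.
Proof.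
move=> le; rewrite /linext (big_fset_incl _ le) // => p _ /mcoeff_outdom ->.
by rewrite scale0r.
Qed.

Lemma linext_is_linear h : linear (linext h).
Proof.
move=> c a b.
pose d := (msupp a `|` msupp b)%fset.
have la : (msupp a `<=` d)%fset by apply: fsubsetUl.
have lb : (msupp b `<=` d)%fset by apply: fsubsetUr.
have lc : (msupp (c *: a + b)%R `<=` d)%fset.
  apply: (fsubset_trans (msuppD_le _ _)); apply: fsetSU; exact: msuppZ_le.
rewrite (linextw h la) (linextw h lb) (linextw h lc) scaler_sumr -big_split /=.
by apply: eq_bigr => p _; rewrite mcoeffD mcoeffZ scalerDl scalerA.
Qed.
HB.instance Definition _ h := GRing.isLinear.Build R {malg R[K]} V _ (linext h)
  (linext_is_linear h).

Lemma linextU h (p : K) : linext h << p >> = h p.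
Proof. by rewrite /linext msuppU oner_eq0 big_seq_fset1 mcoeffUU scale1r. Qed.

Lemma eq_linext h h' : h =1 h' -> linext h =1 linext h'.
Proof. by move=> e a; apply: eq_bigr => p _; rewrite e. Qed.

Lemma linextDr c h h' a :
  linext (fun p => c *: h p + h' p) a = c *: linext h a + linext h' a.
Proof.
rewrite /linext scaler_sumr -big_split /=; apply: eq_bigr => p _.
by rewrite scalerDr !scalerA mulrC.
Qed.

Lemma malg_lin_ext (f g : {malg R[K]} -> V) : linear f -> linear g ->
  (forall p, f << p >> = g << p >>) -> f =1 g.
Proof.
move=> lf lg e a.
have E (h : {malg R[K]} -> V) : linear h -> h a = linext (fun p => h << p >>) a.
  move=> lh; rewrite {1}(monalgE a).
  have h0 : h 0 = 0.
    by have := lh (-1) 0 0; rewrite scaler0 addr0 scaleN1r addNr.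
  rewrite /linext; elim: (enum_fset (msupp a)) => [|p r IH].
    by rewrite !big_nil.
  rewrite !big_cons -IH -lh; congr (h (_ + _)).
  by apply/malgP => q; rewrite mcoeffZ !mcoeffU -mulr_natr; case: (p == q);
     rewrite ?mulr1 ?mulr0.
by rewrite (E f lf) (E g lg); apply: eq_linext.
Qed.
End LinearExtension.

Section ZSpan.
Variables (V : zmodType) (X : V -> Prop).

Definition zspan : {pred V} := fun v =>
  `[< forall U : {pred V}, zmod_closed U -> (forall x, X x -> x \in U) ->
      v \in U >].

Lemma zspan_zmod_closed : zmod_closed zspan.
Proof.
split=> [|u v /asboolP hu /asboolP hv]; apply/asboolP => U [U0 UP] UX.
  exact: U0.
exact: (UP _ _ (hu U (conj U0 UP) UX) (hv U (conj U0 UP) UX)).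
Qed.
HB.instance Definition _ := GRing.isZmodClosed.Build V zspan zspan_zmod_closed.

Definition zquot := Quotient.quot zspan.
HB.instance Definition _ := GRing.Zmodule.on zquot.
Definition zquot_pi (v : V) : zquot := \pi_(Quotient.quot zspan) v.
End ZSpan.

Section LSpan.
Variables (R : pzRingType) (V : lmodType R) (X : V -> Prop).

Definition lspan : {pred V} := fun v =>
  `[< forall U : {pred V}, submod_closed U -> (forall x, X x -> x \in U) ->
      v \in U >].

Lemma lspan_submod_closed : submod_closed lspan.
Proof.
split=> [|a u v /asboolP hu /asboolP hv]; apply/asboolP => U [U0 UP] UX.
  exact: U0.
exact: (UP a _ _ (hu U (conj U0 UP) UX) (hv U (conj U0 UP) UX)).
Qed.
HB.instance Definition _ := GRing.isSubmodClosed.Build R V lspan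
  lspan_submod_closed.

Definition lquot := Quotient.quot lspan.
HB.instance Definition _ := GRing.Zmodule.on lquot.
Definition lquot_pi (v : V) : lquot := \pi_(Quotient.quot lspan) v.

Definition lquot_scale (a : R) (x : lquot) : lquot :=
  lquot_pi (a *: repr (x : Quotient.quot lspan)).

Lemma lquot_scale_pi a (v : V) : lquot_scale a (lquot_pi v) = lquot_pi (a *: v).
Proof.
apply/eqP; rewrite /lquot_scale /lquot_pi -Quotient.idealrBE -scalerBr rpredZ //.
by rewrite Quotient.idealrBE reprK.
Qed.

Lemma lquot_piD : {morph lquot_pi : u v / u + v}.
Proof. by move=> u v; rewrite /lquot_pi Quotient.pi_add. Qed.

Lemma lquot_piP (x : lquot) : exists v, x = lquot_pi v.
Proof. by exists (repr (x : Quotient.quot lspan)); rewrite /lquot_pi reprK. Qed.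

Lemma lquot_scaleA a b v :
  lquot_scale a (lquot_scale b v) = lquot_scale (a * b) v.
Proof. by have [w ->] := lquot_piP v; rewrite !lquot_scale_pi scalerA. Qed.

Lemma lquot_scale1 : left_id 1 lquot_scale.
Proof. by move=> v; have [w ->] := lquot_piP v; rewrite lquot_scale_pi scale1r. Qed.

Lemma lquot_scaleDr : right_distributive lquot_scale +%R.
Proof.
move=> a u v; have [u' ->] := lquot_piP u; have [v' ->] := lquot_piP v.
by rewrite -lquot_piD !lquot_scale_pi scalerDr lquot_piD.
Qed.

Lemma lquot_scaleDl v : {morph lquot_scale^~ v : a b / a + b}.
Proof.
move=> a b; have [v' ->] := lquot_piP v.
by rewrite !lquot_scale_pi scalerDl lquot_piD.
Qed.

HB.instance Definition _ := GRing.Zmodule_isLmodule.Build R lquot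
  lquot_scaleA lquot_scale1 lquot_scaleDr lquot_scaleDl.

Lemma lquot_pi_is_linear : linear lquot_pi.
Proof. by move=> a u v; rewrite lquot_piD -lquot_scale_pi. Qed.

Lemma lquot_pi_rel x : X x -> lquot_pi x = 0.
Proof.
move=> Xx; have -> : 0 = lquot_pi 0.
  by have := lquot_pi_is_linear (-1) 0 0; rewrite scaler0 addr0 scaleN1r addNr.
apply/eqP; rewrite /lquot_pi -Quotient.idealrBE subr0.
by apply/asboolP => U _; apply.
Qed.

Lemma lquot_lift (W : lmodType R) (f : V -> W) : linear f ->
  (forall x, X x -> f x = 0) ->
  exists2 g : lquot -> W, linear g & forall v, g (lquot_pi v) = f v.
Proof.
move=> lf fX.
have f0 : f 0 = 0.
  by have := lf (-1) 0 0; rewrite scaler0 addr0 scaleN1r addNr.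
pose g (x : lquot) := f (repr (x : Quotient.quot lspan)).
have gpi v : g (lquot_pi v) = f v.
  rewrite /g; set w := repr _.
  have : w - v \in lspan by rewrite Quotient.idealrBE reprK.
  move=> /asboolP/(_ (fun x => f x == 0)) h.
  have /eqP : f (w - v) == 0.
    apply: h => [|x Xx]; last by rewrite unfold_in /= fX.
    split=> [|a x y]; rewrite !unfold_in /= ?f0 //.
    by move=> /eqP fx /eqP fy; rewrite lf fx fy scaler0 addr0.
  by rewrite -[w - v]addrC -scaleN1r lf scaleN1r addrC => /subr0_eq.
exists g => // a x y; have [u ->] := lquot_piP x; have [v ->] := lquot_piP y.
by rewrite -lquot_pi_is_linear !gpi lf.
Qed.
End LSpan.

(* [base_change k A] is A (x)_Z k: the free k-vector space on the elements of A *)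
(* modulo the additivity relations is the universal k-vector space receiving an *)
(* additive map from A; [tensor1 k a] is a (x) 1.                               *)
Section BaseChange.
Variables (k : fieldType) (A : zmodType).

Definition additivity_rel (x : {malg k[A]}) : Prop :=
  exists a b : A, x = << a + b >> - << a >> - << b >>.

Definition base_change := lquot additivity_rel.
HB.instance Definition _ := GRing.Lmodule.on base_change.

Definition tensor1 (a : A) : base_change := lquot_pi additivity_rel << a >>.

Lemma base_change_universal (W : lmodType k) (f : A -> W) :
  {morph f : a b / a + b} ->
  exists g : base_change -> W, unique
    (fun g => linear g /\ forall a, g (tensor1 a) = f a) g.
Proof.
move=> fD; have [||g lg gE] := @lquot_lift k _ additivity_rel W (linext f).
- exact: linext_is_linear.
- move=> _ [a [b ->]].
  by rewrite !linearB /= !linextU fD addrAC addrK subrr.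
exists g; split=> [|g' [lg' g'E]]; first by split=> // a; rewrite gE linextU.
apply/funext => x; have [v ->] := lquot_piP x.
have lp := lquot_pi_is_linear additivity_rel.
apply: (malg_lin_ext (f := fun v => g (lquot_pi additivity_rel v))
  (g := fun v => g' (lquot_pi additivity_rel v))) => [c u w|c u w|a].
- by rewrite lp lg.
- by rewrite lp lg'.
by rewrite gE linextU -g'E.
Qed.
End BaseChange.

Section RingQuotient.
Variables (R : pzRingType) (X : R -> Prop).

Definition two_sided_ideal (I : {pred R}) : Prop :=
  [/\ zmod_closed I, forall a u, u \in I -> a * u \in I
    & forall a u, u \in I -> u * a \in I].

Definition ideal_gen : {pred R} := fun v =>
  `[< forall I : {pred R}, two_sided_ideal I -> (forall x, X x -> x \in I) ->
      v \in I >].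

Lemma ideal_gen_two_sided : two_sided_ideal ideal_gen.
Proof.
split.
- split=> [|u v /asboolP hu /asboolP hv]; apply/asboolP => I II IX.
    by case: (II) => -[].
  by have [[_ IB] _ _] := II; apply: IB; [apply: hu | apply: hv].
- move=> a u /asboolP hu; apply/asboolP => I II IX.
  by have [_ IM _] := II; apply: IM; apply: hu.
move=> a u /asboolP hu; apply/asboolP => I II IX.
by have [_ _ IM] := II; apply: IM; apply: hu.
Qed.
HB.instance Definition _ := GRing.isZmodClosed.Build R ideal_gen
  (let: And3 h _ _ := ideal_gen_two_sided in h).

Definition ring_quot := Quotient.quot ideal_gen.
HB.instance Definition _ := GRing.Zmodule.on ring_quot.
Definition ring_quot_pi (x : R) : ring_quot := \pi_(Quotient.quot ideal_gen) x.

Definition ring_quot_mul (x y : ring_quot) : ring_quot :=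
  ring_quot_pi (repr (x : Quotient.quot ideal_gen) *
                repr (y : Quotient.quot ideal_gen)).

Lemma ring_quot_piP (x : ring_quot) : exists v, x = ring_quot_pi v.
Proof.
by exists (repr (x : Quotient.quot ideal_gen)); rewrite /ring_quot_pi reprK.
Qed.

Lemma ring_quot_piD : {morph ring_quot_pi : x y / x + y}.
Proof. by move=> x y; rewrite /ring_quot_pi Quotient.pi_add. Qed.

Lemma ring_quot_piM x y :
  ring_quot_mul (ring_quot_pi x) (ring_quot_pi y) = ring_quot_pi (x * y).
Proof.
have [_ IMl IMr] := ideal_gen_two_sided.
rewrite /ring_quot_mul; set x' := repr _; set y' := repr _.
have dx : x' - x \in ideal_gen by rewrite Quotient.idealrBE reprK.
have dy : y' - y \in ideal_gen by rewrite Quotient.idealrBE reprK.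
apply/eqP; rewrite /ring_quot_pi -Quotient.idealrBE.
have -> : x' * y' - x * y = x' * (y' - y) + (x' - x) * y.
  by rewrite mulrBr mulrBl addrA subrK.
by apply: rpredD; [apply: IMl | apply: IMr].
Qed.

Lemma ring_quot_mulA : associative ring_quot_mul.
Proof.
move=> x y z; have [x' ->] := ring_quot_piP x; have [y' ->] := ring_quot_piP y.
by have [z' ->] := ring_quot_piP z; rewrite !ring_quot_piM mulrA.
Qed.

Lemma ring_quot_mul1r : left_id (ring_quot_pi 1) ring_quot_mul.
Proof. by move=> x; have [x' ->] := ring_quot_piP x; rewrite ring_quot_piM mul1r. Qed.

Lemma ring_quot_mulr1 : right_id (ring_quot_pi 1) ring_quot_mul.
Proof. by move=> x; have [x' ->] := ring_quot_piP x; rewrite ring_quot_piM mulr1. Qed.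

Lemma ring_quot_mulDl : left_distributive ring_quot_mul +%R.
Proof.
move=> x y z; have [x' ->] := ring_quot_piP x; have [y' ->] := ring_quot_piP y.
have [z' ->] := ring_quot_piP z.
by rewrite -ring_quot_piD !ring_quot_piM mulrDl ring_quot_piD.
Qed.

Lemma ring_quot_mulDr : right_distributive ring_quot_mul +%R.
Proof.
move=> x y z; have [x' ->] := ring_quot_piP x; have [y' ->] := ring_quot_piP y.
have [z' ->] := ring_quot_piP z.
by rewrite -ring_quot_piD !ring_quot_piM mulrDr ring_quot_piD.
Qed.

HB.instance Definition _ := GRing.Zmodule_isPzRing.Build ring_quot
  ring_quot_mulA ring_quot_mul1r ring_quot_mulr1
  ring_quot_mulDl ring_quot_mulDr.
End RingQuotient.

(* The left ideal R e, as a Z-module. *)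
Section LeftIdeal.
Variables (R : pzRingType) (e : R).

Definition principal_left : {pred R} := fun x => `[< exists a, x = a * e >].

Lemma principal_left_zmod_closed : zmod_closed principal_left.
Proof.
split=> [|x y /asboolP[a ->] /asboolP[b ->]]; apply/asboolP.
  by exists 0; rewrite mul0r.
by exists (a - b); rewrite mulrBl.
Qed.
HB.instance Definition _ := GRing.isZmodClosed.Build R principal_left
  principal_left_zmod_closed.

Definition left_ideal := {x : R | x \in principal_left}.
HB.instance Definition _ := SubType.on left_ideal.
HB.instance Definition _ := [Choice of left_ideal by <:].
HB.instance Definition _ := [SubChoice_isSubZmodule of left_ideal by <:].
End LeftIdeal.

Record matroid (E : finType) := Matroid {
  rank : {set E} -> nat;
  rank_le_card : forall A, (rank A <= #|A|)%N;
  rank_mono : forall A B : {set E}, A \subset B -> (rank A <= rank B)%N;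
  rank_submod : forall A B,
    (rank (A :|: B) + rank (A :&: B) <= rank A + rank B)%N
}.

Section Matroid.
Variables (E : finType) (M : matroid E).
Implicit Types (K L F G X : {set E}) (s t : seq {set E}).

Definition flat K : bool :=
  [forall x, (x \notin K) ==> (rank M K < rank M (x |: K))%N].

Definition covered K L : bool :=
  [&& flat K, flat L, K \proper L &
      [forall X, flat X ==> ~~ ((K \proper X) && (X \proper L))]].

Definition adjacent K L : bool := covered K L || covered L K.

Definition is_flag_path s : bool :=
  if s is K :: s' then flat K && path adjacent K s' else false.

Record flag_path := FlagPath {
  path_flats :> seq {set E};
  path_flatsP : is_flag_path path_flats
}.
HB.instance Definition _ := [isSub for path_flats].
HB.instance Definition _ := [Choice of flag_path by <:].

Definition path_start s := head set0 s.
Definition path_end s := last set0 s.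

Definition path_alg := {malg int[flag_path]}.
HB.instance Definition _ := GRing.Lmodule.on path_alg.

(* The basis element of a sequence that is a flag path, and 0 otherwise. *)
Definition path_elt s : path_alg :=
  if insub s is Some p then << (p : flag_path) >> else 0.

Definition path_concat (p q : flag_path) : path_alg :=
  if path_end p == path_start q then path_elt (p ++ behead q) else 0.

Definition path_mul (a b : path_alg) : path_alg :=
  linext (fun p => linext (path_concat p) b) a.

Definition path_one : path_alg := \sum_(K | flat K) path_elt [:: K].

Lemma path_mul_linl b : linear (path_mul^~ b).
Proof. exact: linext_is_linear. Qed.

Lemma path_mul_linr a : linear (path_mul a).
Proof.
move=> c b b'; rewrite /path_mul.
rewrite (eq_linext (h' := fun p => c *: linext (path_concat p) b +
                                   linext (path_concat p) b')); last first.
  by move=> p; exact: linext_is_linear.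
exact: linextDr.
Qed.

Lemma path_mulUU (p q : flag_path) : path_mul << p >> << q >> = path_concat p q.
Proof. by rewrite /path_mul !linextU. Qed.

Lemma path_mul0r a : path_mul a 0 = 0.
Proof.
by have := path_mul_linr a (-1) 0 0; rewrite scaler0 addr0 scaleN1r addNr.
Qed.

Lemma path_mul0l a : path_mul 0 a = 0.
Proof.
by have := path_mul_linl a (-1) 0 0; rewrite scaler0 addr0 scaleN1r addNr.
Qed.

Lemma path_eltE (p : flag_path) : path_elt p = << p >>.
Proof. by rewrite /path_elt valK. Qed.

Lemma path_eltI s (sP : is_flag_path s) : path_elt s = << FlagPath sP >>.
Proof. by rewrite -path_eltE. Qed.

Lemma flag_path_cons (p : flag_path) :
  exists K s, [/\ p = K :: s :> seq _, flat K & path adjacent K s].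
Proof. by case: p => -[|K s] //= /andP[fK Ks]; exists K, s. Qed.

Lemma covered_flat K L : covered K L -> flat K && flat L.
Proof. by case/and4P=> -> ->. Qed.

Lemma path_flat K s : flat K -> path adjacent K s -> flat (last K s).
Proof.
elim: s K => //= L s IH K fK /andP[/orP[]/covered_flat/andP[f1 f2]]; exact: IH.
Qed.

Lemma is_flag_path_glue (p q : flag_path) :
  path_end p = path_start q -> is_flag_path (p ++ behead q).
Proof.
have [K [s [-> fK Ks]]] := flag_path_cons p.
have [L [t [-> fL Lt]]] := flag_path_cons q.
by rewrite /path_end /path_start /= cat_path fK Ks => ->.
Qed.

Lemma path_concatE (p q : flag_path) (e : path_end p = path_start q) :
  path_concat p q = << FlagPath (is_flag_path_glue e) >>.
Proof. by rewrite /path_concat; case: eqP => // _; exact: path_eltI. Qed.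

Lemma path_concatN (p q : flag_path) :
  path_end p != path_start q -> path_concat p q = 0.
Proof. by rewrite /path_concat => /negPf ->. Qed.

Lemma path_end_glue (p q : flag_path) :
  path_end p = path_start q -> path_end (p ++ behead q) = path_end q.
Proof.
have [K [s [-> _ _]]] := flag_path_cons p.
have [L [t [-> _ _]]] := flag_path_cons q.
by rewrite /path_end /path_start /= last_cat => ->.
Qed.

Lemma path_start_glue (p q : flag_path) :
  path_start (p ++ behead q) = path_start p.
Proof. by have [K [s [-> _ _]]] := flag_path_cons p. Qed.

Lemma path_mulA : associative path_mul.
Proof.
move=> a b c.
suff E0 p b' c' : path_mul << p >> (path_mul b' c') =
                  path_mul (path_mul << p >> b') c'.
  apply: (malg_lin_ext (f := fun a => path_mul a (path_mul b c))
    (g := fun a => path_mul (path_mul a b) c)) a => [||p]; last exact: E0.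
    exact: path_mul_linl.
  by move=> x u v; rewrite !path_mul_linl.
suff E1 q c'' : path_mul << p >> (path_mul << q >> c'') =
                path_mul (path_mul << p >> << q >>) c''.
  apply: (malg_lin_ext (f := fun b => path_mul << p >> (path_mul b c'))
    (g := fun b => path_mul (path_mul << p >> b) c')) b' => [||q]; last exact: E1.
    by move=> x u v; rewrite path_mul_linl path_mul_linr.
  by move=> x u v; rewrite path_mul_linr path_mul_linl.
apply: (malg_lin_ext (f := fun c => path_mul << p >> (path_mul << q >> c))
  (g := fun c => path_mul (path_mul << p >> << q >>) c)) c'' => [||r].
- by move=> x u v; rewrite !path_mul_linr.
- exact: path_mul_linr.
rewrite !path_mulUU.
have [epq|npq] := eqVneq (path_end p) (path_start q); last first.
  rewrite (path_concatN npq) path_mul0l.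
  have [eqr|nqr] := eqVneq (path_end q) (path_start r); last first.
    by rewrite path_concatN // path_mul0r.
  by rewrite path_concatE path_mulUU path_concatN //= path_start_glue.
rewrite (path_concatE epq) path_mulUU.
have [eqr|nqr] := eqVneq (path_end q) (path_start r); last first.
  by rewrite path_concatN // path_mul0r path_concatN //= path_end_glue.
rewrite (path_concatE eqr) path_mulUU /path_concat /= path_start_glue.
rewrite path_end_glue // epq eqr !eqxx; congr path_elt.
by have [L [t [-> _ _]]] := flag_path_cons q; rewrite /= catA.
Qed.

Lemma path_mul_suml (I : finType) (P : pred I) (f : I -> path_alg) b :
  path_mul (\sum_(i | P i) f i) b = \sum_(i | P i) path_mul (f i) b.
Proof. exact: linear_sum. Qed.

Lemma path_mul_sumr (I : finType) (P : pred I) (f : I -> path_alg) a :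
  path_mul a (\sum_(i | P i) f i) = \sum_(i | P i) path_mul a (f i).
Proof.
apply: (big_morph (path_mul a)) => [x y|]; last exact: path_mul0r.
by have := path_mul_linr a 1 x y; rewrite !scale1r.
Qed.

Lemma path_mul1l : left_id path_one path_mul.
Proof.
apply: malg_lin_ext => [||p]; [exact: path_mul_linr | by [] |].
have [K [s [eP fK Ks]]] := flag_path_cons p.
have E0 L : flat L -> path_mul (path_elt [:: L]) << p >> =
                      if L == K then << p >> else 0.
  move=> fL; have LP : is_flag_path [:: L] by rewrite /= fL.
  rewrite (path_eltI LP) path_mulUU /path_concat /path_end /path_start /= eP /=.
  by case: eqP => // ->; rewrite -eP path_eltE.
rewrite /path_one path_mul_suml (bigD1 K) //= E0 // eqxx big1 ?addr0 //.
by move=> L /andP[fL nL]; rewrite E0 // (negPf nL).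
Qed.

Lemma path_mul1r : right_id path_one path_mul.
Proof.
apply: (malg_lin_ext (f := path_mul^~ path_one)) => [||p].
- exact: path_mul_linl.
- by [].
have [K [s [eP fK Ks]]] := flag_path_cons p.
have E0 L : flat L -> path_mul << p >> (path_elt [:: L]) =
                      if L == last K s then << p >> else 0.
  move=> fL; have LP : is_flag_path [:: L] by rewrite /= fL.
  rewrite (path_eltI LP) path_mulUU /path_concat /path_end /path_start /= cats0.
  by rewrite path_eltE eP /= eq_sym.
have fl := path_flat fK Ks.
rewrite /path_one path_mul_sumr (bigD1 (last K s)) //= E0 // eqxx big1 ?addr0 //.
by move=> L /andP[fL nL]; rewrite E0 // (negPf nL).
Qed.

Lemma path_mulDl : left_distributive path_mul +%R.
Proof.
by move=> a b c; have := path_mul_linl c 1 a b; rewrite !scale1r.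
Qed.

Lemma path_mulDr : right_distributive path_mul +%R.
Proof.
by move=> a b c; have := path_mul_linr a 1 b c; rewrite !scale1r.
Qed.

HB.instance Definition _ := GRing.Zmodule_isPzRing.Build path_alg
  path_mulA path_mul1l path_mul1r path_mulDl path_mulDr.

(* Both right-hand sides below are genuine flag paths: if K and K' are covered  *)
(* by L and K :&: K' is covered by K, then K :&: K' is also covered by K'.      *)
Definition wedge_value K L K' : path_alg :=
  if K == K' then path_elt [:: K] *+ #|L :\: K|
  else if covered (K :&: K') K then - path_elt [:: K; K :&: K'; K']
  else 0.

Inductive S_relation : path_alg -> Prop :=
| FS_up L K : flat L -> flat K -> L \proper K -> rank M K = (rank M L).+2 ->
    S_relation (\sum_(X | covered L X && covered X K) path_elt [:: L; X; K])
| FS_down L K : flat L -> flat K -> L \proper K -> rank M K = (rank M L).+2 ->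
    S_relation (\sum_(X | covered L X && covered X K) path_elt [:: K; X; L])
| Wedge K L K' : covered K L -> covered K' L ->
    S_relation (path_elt [:: K; L; K'] - wedge_value K L K').

Definition S := ring_quot S_relation.
HB.instance Definition _ := GRing.PzRing.on S.

Definition S_path s : S := ring_quot_pi S_relation (path_elt s).

Definition step_degree K L : int := if L \proper K then 1 else -1.

Definition path_degree s : int :=
  if s is K :: s' then \sum_(d <- pairmap step_degree K s') d else 0.

Definition S_grade (i : int) : {pred S} :=
  zspan (fun x => exists p : flag_path, path_degree p = i /\ x = S_path p).

Definition standard_sub F (x : left_ideal (S_path [:: F])) : Prop :=
  exists p : flag_path,
    [/\ path_end p = F, exists2 K, K \in (p : seq _) & ~~ (F \subset K)
      & val x = S_path p].

Definition standard F := zquot (@standard_sub F).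
HB.instance Definition _ F := GRing.Zmodule.on (standard F).

(* The grading inherited from S: the flag K_m > ... > K_1 > F has degree m. *)
Definition standard_grade F (i : int) (y : standard F) : Prop :=
  exists2 x : left_ideal (S_path [:: F]),
    val x \in S_grade i & y = zquot_pi (@standard_sub F) x.

Fixpoint mobius_rec (n : nat) F G : int :=
  if F == G then 1 else
  if n is n'.+1 then
    - \sum_(H | [&& flat H, F \subset H & H \proper G]) mobius_rec n' F H
  else 0.

Definition mobius F G : int := mobius_rec #|G| F G.

Lemma mobiusE F G : mobius F G =
  if F == G then 1
  else - \sum_(H | [&& flat H, F \subset H & H \proper G]) mobius F H.
Proof.
have fuel : forall n m G', (#|G'| <= n)%N -> (#|G'| <= m)%N ->
    mobius_rec n F G' = mobius_rec m F G'.
  have rec0 G' : (#|G'| <= 0)%N ->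
      forall n, \sum_(H | [&& flat H, F \subset H & H \proper G'])
                  mobius_rec n F H = 0.
    by move=> G0 n; apply: big1 => H /and3P[_ _ /proper_card];
       rewrite ltnNge (leq_trans G0).
  elim=> [|n IH] [|m] G' //= len lem; case: eqP => // _.
  - by rewrite rec0 // oppr0.
  - by rewrite rec0 // oppr0.
  congr (- _); apply: eq_bigr => H /and3P[_ _ /proper_card ltH].
  by rewrite (IH m) // -ltnS (leq_trans ltH).
rewrite {1}/mobius; case eG: #|G| => [|n] /=; case: eqP => // _.
  by rewrite big1 ?oppr0 // => H /and3P[_ _ /proper_card]; rewrite eG.
congr (- _); apply: eq_bigr => H /and3P[_ _ /proper_card ltH].
by apply: fuel => //; rewrite -ltnS -eG.
Qed.

Definition mobius_plus F G : int :=
  (-1) ^+ (rank M G - rank M F) * mobius F G.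

(* Rank and characteristic polynomial of the contraction M_F, expressed in M:   *)
(* the flats of M_F are the G :\: F for the flats G of M containing F.         *)
Definition contraction_rank F : nat := rank M setT - rank M F.

Definition contraction_charpoly F : {poly int} :=
  \sum_(G | flat G && (F \subset G))
    mobius F G *: 'X^(rank M setT - rank M G).

End Matroid.

Arguments S_grade {E} M i.
Arguments standard_grade {E} M F i.

Section GradedDimension.
Variables (k : fieldType) (V : lmodType k).

(* The coordinates of v are with respect to a basis of X. *)
Definition has_dim (X : {pred V}) (n : nat) : Prop :=
  exists b : 'I_n -> V, (forall j, b j \in X) /\
    forall v, v \in X ->
      exists! c : 'rV[k]_n, v = \sum_j c ord0 j *: b j.

Definition is_grading (X : int -> {pred V}) : Prop :=
  [/\ forall i, submod_closed (X i),
      forall v, exists (s : seq int) (f : int -> V),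
        (forall i, f i \in X i) /\ v = \sum_(i <- s) f i
    & forall (s : seq int) (f : int -> V), uniq s ->
        (forall i, f i \in X i) -> \sum_(i <- s) f i = 0 ->
        forall i, i \in s -> f i = 0].

End GradedDimension.

(* Laurent polynomials in t are compared in the field of rational functions. *)
Definition ratfun := {fraction {poly int}}.
HB.instance Definition _ := GRing.Field.on ratfun.
Definition tvar : ratfun := tofrac 'X.

Definition eval_ratfun (p : {poly int}) (x : ratfun) : ratfun :=
  (map_poly (fun a : int => a%:~R) p).[x].

(* P is the Laurent polynomial sum_i dim (X i) t^i. *)
Definition has_graded_dim (k : fieldType) (V : lmodType k)
    (X : int -> {pred V}) (P : ratfun) : Prop :=
  is_grading X /\
  exists (d : int -> nat) (s : seq int),
    [/\ uniq s, forall i, has_dim (X i) (d i), forall i, i \notin s -> d i = 0%N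
      & P = \sum_(i <- s) (d i)%:R * tvar ^ i].

Section OverField.
Variables (k : fieldType) (E : finType) (M : matroid E).

Definition Sk := base_change k (S M).
HB.instance Definition _ := GRing.Lmodule.on Sk.

Definition Sk_grade (i : int) : {pred Sk} :=
  lspan (fun z => exists2 x, x \in S_grade M i & z = tensor1 k x).

Definition standardk (F : {set E}) := base_change k (standard M F).
HB.instance Definition _ F := GRing.Lmodule.on (standardk F).

Definition standardk_grade (F : {set E}) (i : int) : {pred standardk F} :=
  lspan (fun z => exists2 y : standard M F, standard_grade M F i y & z = tensor1 k y).
End OverField.

Arguments Sk_grade k {E} M i.
Arguments standardk_grade k {E} M F i.

(* Main.v *)
(* The wedge relation rewrites every flag path into a descending flag [d] from  *)
(* K to some flat F followed by an ascending flag from F to L. Modulo (FS), the *)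
(* flags from K to F are spanned by those in which every step avoids a chosen   *)
(* element, and by Weisner's theorem there are mu^+(F, K) of these. For linear  *)
(* independence, S(M) acts on the exterior algebra of each contraction M_F,     *)
(* more precisely on the span of its independent monomials: an up step K < L is *)
(* multiplication by the sum of the elements of L \ K, a down step is a         *)
(* residue, (FS) is d^2 = 0 and the wedge relation is the anticommutation of    *)
(* creation and annihilation operators. The two kinds of steps are transposes   *)
(* of each other, so that a normal form d * u through F acts by a matrix of     *)
(* rank one, a product of the functionals of d and u, which are independent     *)
(* over Z. Hence S(M) and the standard modules are free over Z with bases of    *)
(* homogeneous elements, and tensoring with k only requires counting these.     *)
Require Import Defs.
From HB Require Import structures.
From mathcomp Require Import all_boot all_order all_algebra.
From mathcomp Require Import fraction finmap monalg.
From mathcomp Require Import boolp.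
From mathcomp Require Import zify ring.

Set Implicit Arguments.
Unset Strict Implicit.
Unset Printing Implicit Defensive.

Import Order.TTheory GRing.Theory Num.Theory.
Local Open Scope ring_scope.

(** * Closure and bases of minors *)

(** Both formulas count explicit homogeneous $\mathbb Z$-bases. For a flat $F$ the [standard_flags]
    are descending flags to $F$ in which every step drops an element chosen in advance. By Weisner's
    theorem ([mobius_weisner]) exactly $\mu^+(F,K)$ of them start at $K$ ([size_nbc_flags]). The
    basis of $S(M)$ consists of the products of a standard flag $d$ down to $F$ and a reversed
    standard flag $u$ up from $F$, for all flats $F$. They span because the wedge relation sorts
    every path into down steps followed by up steps, and (FS) then straightens each half
    ([standard_flags_span]). They are independent because $S(M)$ acts on the exterior algebra of
    each contraction $M_F$ ([path_alg_act_rel], [S_actM]). A path through a flat not containing $F$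
    acts by zero, so a relation can be peeled from the largest flats downwards. A product through
    $F$ itself acts by a matrix of rank one, and the standard flags to $F$ give independent vectors
    ([standard_flags_free], [S_basis_free]). In the standard module of $F$ exactly the products with
    trivial $u$ through $F$ survive ([to_standard_span], [standard_basis_free]). A homogeneous
    $\mathbb Z$-basis stays a basis over $k$ ([free_graded_dim]). Since $u$ contributes its length
    with the opposite sign, $S_k(M)$ has graded dimension $\sum_F D_F(t)\,D_F(t^{-1})$, where $D_F$
    is that of the standard module. Writing $D_F$ through $p(M_F)$, the two prefactors are inverse
    to each other ([sum_S_index]). *)

Section MatroidTheory.
Variables (E : finType) (M : matroid E).
Implicit Types (A B F G K L X Y R S T : {set E}).
Notation rk := (rank M).
Local Open Scope nat_scope.

Definition flat_closure A : {set E} := [set x | rk (x |: A) == rk A].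

Lemma rank_setU A B : rk (A :|: B) <= rk A + #|B|.
Proof.
apply: leq_trans (leq_trans (leq_addr _ _) (rank_submod M A B)) _.
by rewrite leq_add2l rank_le_card.
Qed.

Lemma rank_setU1 x A : rk (x |: A) <= (rk A).+1.
Proof. by have := rank_setU A [set x]; rewrite cards1 addn1 setUC. Qed.

Lemma sub_closure A : A \subset flat_closure A.
Proof. by apply/subsetP => x xA; rewrite inE (setUidPr _) // sub1set. Qed.

(** Elements that do not raise the rank singly do not raise it jointly. Remove one element [x] of
    [B] and apply submodularity to [x |: A] and [A :|: B :\ x], whose intersection contains [A]. *)
Lemma rank_setU_closure A B : B \subset flat_closure A -> rk (A :|: B) = rk A.
Proof.
elim: {B}_.+1 {-2}B (ltnSn #|B|) => // n IH B cB sB.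
have [->|[x xB]] := set_0Vmem B; first by rewrite setU0.
have sB' : B :\ x \subset flat_closure A by rewrite (subset_trans _ sB) // subsetDl.
have := IH (B :\ x); rewrite (cardsD1 x B) xB in cB => /(_ cB sB') e.
have /eqP ex : rk (x |: A) == rk A by have := subsetP sB x xB; rewrite inE.
have := rank_submod M (x |: A) (A :|: B :\ x); rewrite ex e.
have -> : (x |: A) :|: (A :|: B :\ x) = A :|: B.
  by rewrite -{2}(setD1K xB) !setUA; congr (_ :|: _); rewrite -setUA setUid setUC.
have /(rank_mono M) : A \subset (x |: A) :&: (A :|: B :\ x).
  by rewrite subsetI subsetUr subsetUl.
have /(rank_mono M) : A \subset A :|: B by rewrite subsetUl.
lia.
Qed.

Lemma rank_closure A : rk (flat_closure A) = rk A.
Proof.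
by have := rank_setU_closure (subxx (flat_closure A)); rewrite (setUidPr (sub_closure A)).
Qed.

Lemma closure_flat A : flat M (flat_closure A).
Proof.
apply/forallP => x; apply/implyP; rewrite inE rank_closure => nx.
have lt : rk A < rk (x |: A).
  by rewrite ltn_neqAle eq_sym nx rank_mono // subsetUr.
by rewrite (leq_trans lt) // rank_mono // setUS // sub_closure.
Qed.

Lemma flat_rank_eq K L : flat M K -> K \subset L -> rk L <= rk K -> L = K.
Proof.
move=> /forallP fK KL le; apply/eqP; rewrite eqEsubset KL andbT.
apply/subsetP => x xL; apply/negPn/negP => xK.
have := implyP (fK x) xK; rewrite ltnNge (leq_trans _ le) // rank_mono //.
by rewrite subUset sub1set xL.
Qed.

Lemma flat_proper_rank K L : flat M K -> K \proper L -> rk K < rk L.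
Proof.
move=> fK /properP[KL [x xL xK]]; rewrite ltnNge; apply/negP => le.
by move: xK; rewrite -(flat_rank_eq fK KL le) xL.
Qed.

Lemma closure_min A K : flat M K -> A \subset K -> flat_closure A \subset K.
Proof.
move=> /forallP fK AK; apply/subsetP => x; rewrite inE => /eqP e.
apply/negPn/negP => xK; have := implyP (fK x) xK.
have := rank_submod M (x |: A) K; rewrite e.
have -> : x |: A :|: K = x |: K by rewrite -setUA (setUidPr AK).
have /(rank_mono M) : A \subset (x |: A) :&: K by rewrite subsetI subsetUr.
lia.
Qed.

Lemma closure_eq A K : flat M K -> A \subset K -> rk K <= rk A -> flat_closure A = K.
Proof.
move=> fK AK le; apply/esym/flat_rank_eq; rewrite ?closure_flat ?rank_closure //.
exact: closure_min.
Qed.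

Lemma flatI K L : flat M K -> flat M L -> flat M (K :&: L).
Proof.
move=> fK fL; suff -> : K :&: L = flat_closure (K :&: L) by apply: closure_flat.
apply/eqP; rewrite eqEsubset sub_closure subsetI !closure_min ?subsetIl //.
exact: subsetIr.
Qed.

(** For [x] in [L] outside [K], the closure of [x |: K] is a flat strictly above [K] and inside [L].
    A covering thus forces it to be [L], and the rank rises by one. *)
Lemma coveredP K L : reflect [/\ flat M K, flat M L, K \subset L & rk L = (rk K).+1]
  (covered M K L).
Proof.
apply: (iffP and4P) => [[fK fL /[dup] KL /properP[sKL [x xL xK]]]|[fK fL KL e]].
  move/forallP/(_ (flat_closure (x |: K))); rewrite closure_flat /= => h.
  split=> //; have lt := flat_proper_rank fK KL.
  have sX : flat_closure (x |: K) \subset L.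
    by rewrite closure_min // subUset sub1set xL.
  have KX : K \proper flat_closure (x |: K).
    apply/properP; split.
      exact: subset_trans (subsetUr _ _) (sub_closure _).
    by exists x => //; apply: (subsetP (sub_closure _)); rewrite setU11.
  move: h; rewrite KX /= properE sX negbK => /(rank_mono M); rewrite rank_closure.
  have := rank_setU1 x K; lia.
split=> //.
  rewrite properE KL; apply/negP => LK.
  by have := rank_mono M LK; rewrite e ltnn.
apply/forallP => X; apply/implyP => fX; apply/negP => /andP[h1 h2].
have := flat_proper_rank fK h1; have := flat_proper_rank fX h2; lia.
Qed.

Lemma covered_rank K L : covered M K L -> rk L = (rk K).+1.
Proof. by case/coveredP. Qed.

Lemma covered_sub K L : covered M K L -> K \subset L.
Proof. by case/coveredP. Qed.

Lemma covered_closure L K a : flat M L -> flat M K -> L \subset K ->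
  rk K = (rk L).+2 -> a \in K -> a \notin L ->
  covered M L (flat_closure (a |: L)) && covered M (flat_closure (a |: L)) K.
Proof.
move=> fL fK LK e aK aL.
have r : rk (flat_closure (a |: L)) = (rk L).+1.
  rewrite rank_closure; apply/eqP; rewrite eqn_leq rank_setU1.
  by rewrite (implyP (forallP fL a)).
apply/andP; split; apply/coveredP; rewrite ?closure_flat ?r ?e; split=> //.
  exact: subset_trans (subsetUr _ _) (sub_closure _).
by rewrite closure_min // subUset sub1set aK.
Qed.

Lemma covered_eq_closure L X a : covered M L X -> a \in X -> a \notin L ->
  X = flat_closure (a |: L).
Proof.
case/coveredP=> fL fX LX e aX aL; apply/esym/closure_eq => //.
  by rewrite subUset sub1set aX.
by rewrite e (implyP (forallP fL a)).
Qed.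

(* The bases of the matroid obtained from [M] by restriction to [K] and         *)
(* contraction of [F].                                                          *)
Definition rel_basis F K S : bool :=
  [&& F \subset K, S \subset K, #|S| + rk F == rk K & rk (S :|: F) == rk K].

Lemma rel_basisP F K S : reflect
  [/\ F \subset K, S \subset K, #|S| + rk F = rk K & rk (S :|: F) = rk K]
  (rel_basis F K S).
Proof.
by apply: (iffP and4P) => -[h1 h2 h3 h4]; split=> //; apply/eqP.
Qed.

Lemma rel_basis_closure F K S : flat M K -> rel_basis F K S ->
  flat_closure (S :|: F) = K.
Proof.
move=> fK /rel_basisP[FK SK _ e]; apply: closure_eq => //; last by rewrite e.
by rewrite subUset SK.
Qed.

(** Subsets of independent sets are independent in the contraction: adding [S :\: R] to [R :|: F]
    raises the rank by at most its size, which leaves no slack. *)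
Lemma rel_basis_sub F K R S : rel_basis F K S -> R \subset S ->
  rk (R :|: F) = #|R| + rk F.
Proof.
case/rel_basisP=> FK SK c e RS.
have := rank_setU F R; rewrite setUC.
have := rank_setU (R :|: F) (S :\: R).
have -> : R :|: F :|: S :\: R = S :|: F.
  by rewrite setUAC -{1}(setIidPr RS) setID.
have := cardsID R S; rewrite (setIidPr RS); lia.
Qed.

Lemma rel_basisU1 F X K a T : covered M X K -> rel_basis F X T ->
  a \in K -> a \notin X -> rel_basis F K (a |: T).
Proof.
move=> cXK /[dup] bT /rel_basisP[FX TX c e] aK aX.
have [fX fK XK rK] := coveredP _ _ cXK.
have aT : a \notin T by apply: contra aX; apply: (subsetP TX).
apply/rel_basisP; split.
- exact: subset_trans FX XK.
- by rewrite subUset sub1set aK (subset_trans TX XK).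
- by rewrite cardsU1 aT rK; lia.
apply/eqP; rewrite eqn_leq rank_mono /=; last first.
  by rewrite !subUset sub1set aK (subset_trans TX XK) (subset_trans FX XK).
rewrite -setUA rK -(rank_closure (a |: (T :|: F))).
have sX : X \subset flat_closure (a |: (T :|: F)).
  rewrite -(rel_basis_closure fX bT) closure_min ?closure_flat //.
  exact: subset_trans (subsetUr _ _) (sub_closure _).
apply: flat_proper_rank => //; rewrite properE sX /=.
apply: contra aX => /subsetP; apply.
by apply: (subsetP (sub_closure _)); rewrite setU11.
Qed.

Lemma rel_basisFF F S : rel_basis F F S = (S == set0).
Proof.
rewrite /rel_basis subxx -{2}[rk F]add0n eqn_add2r cards_eq0 /=.
by case: eqP => [->|]; rewrite ?andbF // sub0set set0U eqxx.
Qed.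

End MatroidTheory.

(** * Weisner recursion *)

Section Mobius.
Variables (E : finType) (M : matroid E).
Implicit Types (F G H K L X Y : {set E}) (s c : seq {set E}).
Notation rk := (rank M).

Lemma mobius_sum0 F G : flat M G -> F \proper G ->
  \sum_(H | [&& flat M H, F \subset H & H \subset G]) mobius M F H = 0.
Proof.
move=> fG /[dup] FG /andP[sFG _]; rewrite (bigD1 G) /=; last by rewrite fG sFG subxx.
rewrite mobiusE ifN; last by apply: contraTneq FG => ->; rewrite properxx.
apply/eqP; rewrite addrC subr_eq0; apply/eqP/eq_bigl => H.
by rewrite properEneq -!andbA; congr (_ && (_ && _)); rewrite andbC.
Qed.

(** Group the vanishing Möbius sum over the interval from [F] to [K] by the join of [X] with [a].
    The groups with a join smaller than [K] vanish by induction, so the last one does too. *)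
Lemma mobius_closure_sum0 F K a : flat M F -> a \notin F -> flat M K ->
  F \subset K -> a \in K ->
  \sum_(X | [&& flat M X, F \subset X & flat_closure M (a |: X) == K]) mobius M F X = 0.
Proof.
move=> fF aF; elim: {K}_.+1 {-2}K (ltnSn #|K|) => // n IH K cK fK FK aK.
have pFK : F \proper K by apply/properP; split=> //; exists a.
have := mobius_sum0 fK pFK.
rewrite (partition_big (fun X => flat_closure M (a |: X))
  (fun Y => [&& flat M Y, a \in Y, F \subset Y & Y \subset K])) /=; last first.
  move=> X /and3P[fX FX XK]; rewrite closure_flat closure_min //; last first.
    by rewrite subUset sub1set aK.
  have sX := sub_closure M (a |: X).
  rewrite (subsetP sX) ?setU11 //= andbT.
  by apply: subset_trans sX; rewrite (subset_trans FX) // subsetUr.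
rewrite (bigD1 K) /=; last by rewrite fK aK FK subxx.
rewrite [X in _ + X]big1 => [|Y /andP[/and4P[fY aY FY YK] nYK]]; last first.
  rewrite -[RHS](IH Y) //; last first.
    rewrite -ltnS (leq_trans _ cK) // ltnS proper_card //.
    by rewrite properEneq nYK.
  apply: eq_bigl => X; rewrite -!andbA; do 2 congr (_ && _).
  case: eqP => [e|]; rewrite ?andbF // andbT.
  apply: subset_trans YK; rewrite -e.
  exact: subset_trans (subsetUr _ _) (sub_closure _ _).
rewrite addr0 => e; rewrite -[RHS]e; apply: eq_bigl => X.
rewrite -!andbA; do 2 congr (_ && _).
case: eqP => [e'|]; rewrite ?andbF // andbT.
by rewrite -e' (subset_trans (subsetUr _ _) (sub_closure _ _)).
Qed.

(* Weisner's theorem in a geometric lattice: the flats X with X v a = K, other  *)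
(* than K itself, are the hyperplanes of K avoiding a.                          *)
Lemma mobius_weisner F K a : flat M F -> a \notin F -> flat M K ->
  F \subset K -> a \in K ->
  mobius M F K =
  - \sum_(X | [&& covered M X K, F \subset X & a \notin X]) mobius M F X.
Proof.
move=> fF aF fK FK aK; apply/eqP; rewrite -addr_eq0; apply/eqP.
rewrite -[RHS](mobius_closure_sum0 fF aF fK FK aK) [RHS](bigD1 K) /=; last first.
  rewrite fK FK /=; apply/eqP/closure_eq => //; first by rewrite subUset sub1set aK /=.
  by rewrite rank_mono // subsetUr.
congr (_ + _); apply: eq_bigl => X; apply/and3P/andP.
  move=> [/[dup] cXK /coveredP[fX _ XK e] FX aX]; split; last first.
    by apply: contraNneq aX => ->.
  rewrite fX FX /=; apply/eqP/closure_eq => //; first by rewrite subUset sub1set aK.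
  by rewrite e (implyP (forallP fX a)).
move=> [/and3P[fX FX /eqP e] nXK].
have XK : X \subset K.
  by rewrite -e; exact: subset_trans (subsetUr _ _) (sub_closure _ _).
have aX : a \notin X.
  apply: contraNN nXK => aX; rewrite -e (setUidPr _) ?sub1set //.
  by apply/eqP/esym/closure_eq.
split=> //; apply/coveredP; split=> //.
have := rank_setU1 M a X; rewrite -rank_closure e => le.
apply/eqP; rewrite eqn_leq le; apply: flat_proper_rank => //.
by rewrite properEneq nXK.
Qed.

(** The avoided element depends on [F] and [K] only, so that counting, spanning and independence all
    use the same choice. The default applies only when [K] is contained in [F]. *)
Definition avoids F K X : bool :=
  if [pick a in K :\: F] is Some a then a \notin X else true.

(* Weisner's recursion says that mu^+(F, K) counts these flags; they will turn   *)
(* out to be a basis of the flags from [K] to [F] modulo (FS). The fuel [n] is   *)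
(* meant to be the rank of [K] minus that of [F].                                *)
Fixpoint nbc_flags F (n : nat) K : seq (seq {set E}) :=
  if n is n'.+1 then
    [seq K :: c | X <- [seq X <- index_enum {set E} |
                         [&& covered M X K, F \subset X & avoids F K X]],
                  c <- nbc_flags F n' X]
  else if K == F then [:: [:: F]] else [::].

(** The sign in Weisner's recursion is absorbed by the extra factor $-1$ of each rank, so the signed
    Möbius values add up like sizes of lists. *)
Lemma size_nbc_flags F n K : flat M F -> flat M K -> F \subset K ->
  rk K = (n + rk F)%N -> (size (nbc_flags F n K))%:Z = (-1) ^+ n * mobius M F K.
Proof.
move=> fF; elim: n K => [|n IH] K fK FK e /=.
  have -> : K = F by apply: (@flat_rank_eq _ M) => //; rewrite e.
  by rewrite eqxx mobiusE eqxx.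
have [a aKF] : exists a, a \in K :\: F.
  apply/set0Pn; rewrite setD_eq0; apply/negP => /(rank_mono M).
  by rewrite e addSn ltnNge leq_addl.
rewrite size_allpairs_dep sumnE big_map big_filter raddf_sum /= /avoids.
case: pickP => [{aKF}a|/(_ a)]; last by rewrite /= aKF.
rewrite !inE => /andP[aF aK]; rewrite (mobius_weisner fF aF fK FK aK).
rewrite exprS mulN1r mulrNN mulr_sumr.
apply: eq_bigr => X /and3P[/coveredP[fX _ XK e'] FX _].
by apply: IH => //; apply/eqP; rewrite -eqSS -e' e.
Qed.

Definition flag_to F K c : bool :=
  path (fun K' L => covered M L K') K c && (last K c == F).

Lemma nbc_flagsP F n K c : c \in nbc_flags F n K ->
  exists c', [/\ c = K :: c', flag_to F K c' & size c' = n].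
Proof.
elim: n K c => [|n IH] K c /=.
  by case: eqP => // ->; rewrite inE => /eqP ->; exists [::]; rewrite /flag_to /= eqxx.
case/allpairsPdep=> X [c0 [+ /IH[c' [-> pc sc]] ->]].
rewrite mem_filter => /andP[/and3P[cXK _ _] _].
exists (X :: c'); split=> //=; last by rewrite sc.
by move: pc; rewrite /flag_to /= cXK.
Qed.

Lemma uniq_nbc_flags F n K : uniq (nbc_flags F n K).
Proof.
elim: n K => [|n IH] K /=; first by case: eqP.
apply: allpairs_uniq_dep; first exact: filter_uniq (index_enum_uniq _).
  by move=> X _; apply: IH.
move=> [X c] [Y d] /allpairsPdep[X' [c' [_ /nbc_flagsP[c1 [-> _ _]] [-> ->]]]].
move=> /allpairsPdep[Y' [d' [_ /nbc_flagsP[d1 [-> _ _]] [-> ->]]]].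
by case=> <- <-.
Qed.

Lemma flag_to_sub F K c : flag_to F K c -> F \subset K.
Proof.
rewrite /flag_to; elim: c K => [|L c IH] K /=; first by move/eqP=> ->.
case/andP=> /andP[cLK pc] lc; apply: subset_trans (covered_sub cLK).
by apply: IH; rewrite pc.
Qed.

Lemma flag_to_rank F K c : flag_to F K c -> rk K = (size c + rk F)%N.
Proof.
rewrite /flag_to; elim: c K => [|L c IH] K /=; first by move/eqP=> ->.
case/andP=> /andP[cLK pc] lc; rewrite (covered_rank cLK) addSn -(IH L) //.
by rewrite pc.
Qed.

Lemma flag_to_flat F K c : flat M F -> flag_to F K c -> flat M K.
Proof.
move=> fF /andP[]; case: c => [_ /eqP/= -> //|L c].
by case/andP=> /covered_flat/andP[].
Qed.

End Mobius.

(** * Representation on exterior algebras *)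

Section SignedIncidence.
Variables (E : finType).
Implicit Types (a b : E) (S T U : {set E}).

(* The sign with which e_a /\ e_T is the monomial of [a |: T], for [a \notin T].  *)
Definition insertion_sign a T : int :=
  (-1) ^+ #|[set x in T | (enum_rank x < enum_rank a)%N]|.

Lemma insertion_sign_sqr a T : insertion_sign a T * insertion_sign a T = 1.
Proof. by rewrite -expr2 sqrr_sign. Qed.

Lemma insertion_signU1 a b T : b \notin T -> insertion_sign a (b |: T) =
  (-1) ^+ (enum_rank b < enum_rank a)%N * insertion_sign a T.
Proof.
move=> bT; rewrite /insertion_sign -exprD; congr (_ ^+ _).
rewrite (cardsD1 b) !inE eqxx /=; congr (_ + _)%N; apply: eq_card => x.
by rewrite !inE; case: eqP => //= ->; rewrite (negPf bT).
Qed.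

(** This is $e_a\wedge e_b=-e_b\wedge e_a$: exactly one of the two elements precedes the other. *)
Lemma insertion_sign_anticomm a b T : a != b -> a \notin T -> b \notin T ->
  insertion_sign a (b |: T) * insertion_sign b T =
  - (insertion_sign b (a |: T) * insertion_sign a T).
Proof.
move=> ab aT bT; rewrite !insertion_signU1 //.
have : enum_rank a != enum_rank b by rewrite (inj_eq enum_rank_inj).
rewrite neq_ltn => /orP[] h; rewrite h (leq_gtF (ltnW h)) expr0 expr1 !mul1r !mulN1r.
  by rewrite mulNr opprK mulrC.
by rewrite mulNr mulrC.
Qed.

(** The sum has at most one term, and none unless [S] is [T] with one element added. It is the
    coefficient of $e_S$ in $(\sum_a e_a)\wedge e_T$. *)
Definition deletion_sign S T : int :=
  \sum_(a | (a \notin T) && (S == a |: T)) insertion_sign a T.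

(** Symmetrized, so that one matrix serves for both directions of a step and reversing a path
    transposes its action. *)
Definition incidence_sign S T : int := deletion_sign S T + deletion_sign T S.

Lemma incidence_signC S T : incidence_sign S T = incidence_sign T S.
Proof. exact: addrC. Qed.

Lemma incidence_signU1 a T : a \notin T ->
  incidence_sign (a |: T) T = insertion_sign a T.
Proof.
move=> aT; rewrite /incidence_sign /deletion_sign (bigD1 a) ?aT ?eqxx //= !big1 ?addr0 //.
  move=> b /andP[bT /eqP/setP/(_ a)]; rewrite !inE eqxx /= in bT *.
  by rewrite (negPf aT) orbT.
move=> b /andP[/andP[bT /eqP/setP/(_ b)]]; rewrite !inE eqxx /=.
by rewrite (negPf bT) orbF => ->.
Qed.

Lemma incidence_sign_neq0 S T : incidence_sign S T != 0 ->
  (exists2 a, a \notin T & S = a |: T) \/ (exists2 a, a \notin S & T = a |: S).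
Proof.
have aux A B : deletion_sign A B != 0 -> exists2 a, a \notin B & A = a |: B.
  move=> h; apply/exists2P; apply: contra_neqP h => h; apply: big1 => a /andP[h1 /eqP h2].
  by case: h; exists a.
rewrite /incidence_sign; have [->|/aux] := eqVneq (deletion_sign S T) 0; last by left.
by rewrite add0r => /aux; right.
Qed.

Lemma incidence_sign_card S T : #|S| = #|T|.+1 -> incidence_sign S T != 0 ->
  exists2 a, a \notin T & S = a |: T.
Proof.
move=> e /incidence_sign_neq0[//|[a aS eT]].
by move: e; rewrite eT cardsU1 aS; lia.
Qed.

(* The square of the boundary operator of the exterior algebra vanishes.         *)
Lemma sum_incidence_sign0 S T : #|S| = #|T|.+2 ->
  \sum_(U : {set E} | #|U| == #|T|.+1) incidence_sign S U * incidence_sign U T = 0.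
Proof.
move=> cS; have cSU (U : {set E}) : #|U| = #|T|.+1 -> #|S| = #|U|.+1 by rewrite cS => ->.
have [TS|nTS] := boolP (T \subset S); last first.
  apply: big1 => U /eqP cU; apply/eqP; rewrite mulf_eq0; apply/contraNT: nTS.
  rewrite negb_or => /andP[] /(incidence_sign_card (cSU _ cU)).
  move=> [a _ ->] /(incidence_sign_card cU)[b _ ->].
  by rewrite (subset_trans (subsetUr [set b] T)) ?subsetUr.
have cD : #|S :\: T| = 2.
  by have := cardsID T S; rewrite (setIidPr TS) cS; lia.
have [a [b [ab eD]]] : exists a b, a != b /\ S :\: T = [set a; b].
  by apply/cards2P; rewrite cD.
have aT : a \notin T.
  by have : a \in S :\: T; [rewrite eD !inE eqxx | rewrite inE => /andP[]].
have bT : b \notin T.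
  by have : b \in S :\: T; [rewrite eD !inE eqxx orbT | rewrite inE => /andP[]].
have eS : S = a |: (b |: T) by rewrite -(setID S T) (setIidPr TS) eD setUC setUA.
(* Only two intermediate sets lie between [T] and [S], and their contributions cancel by
   anticommutation. *)
rewrite (bigD1 (a |: T)) /=; last by rewrite cardsU1 aT.
rewrite (bigD1 (b |: T)) /=; last first.
  rewrite cardsU1 bT eqxx; apply/eqP => /setP/(_ b).
  by rewrite !inE eqxx (negPf bT) orbF eq_sym (negPf ab).
rewrite big1 ?addr0 => [|U /andP[/andP[/eqP cU nUa] nUb]]; last first.
  apply/eqP; rewrite mulf_eq0; apply/norP => -[].
  move=> /(incidence_sign_card (cSU _ cU))[c cU' eS'].
  move=> /(incidence_sign_card cU)[d dT eU].
  have : d \in S :\: T by rewrite inE dT eS' eU !inE eqxx orbT.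
  rewrite eD !inE => /orP[] /eqP e; move: nUa nUb; by rewrite eU e eqxx.
have abT : a \notin b |: T by rewrite !inE (negPf ab).
have baT : b \notin a |: T by rewrite !inE eq_sym (negPf ab).
have eS' : S = b |: (a |: T) by rewrite eS setUCA.
rewrite {1}eS' eS !incidence_signU1 //.
by rewrite (insertion_sign_anticomm ab) // addrN.
Qed.

End SignedIncidence.

(** * Matrices of flag paths *)

Section Representation.
Variables (E : finType) (M : matroid E).
Implicit Types (a : E) (F G H K L X Y : {set E}) (S T U : {set E})
  (s t : seq {set E}).
Notation rk := (rank M).

(* The action of flag paths on the exterior algebra of the contraction [M_F],    *)
(* as a matrix indexed by its monomials: a step [K > L] is the residue along     *)
(* [L], the step [L < K] is multiplication by the sum of the elements of         *)
(* [K :\: L], and the monomials of [K] are its bases.                            *)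
Fixpoint act F s S T : int :=
  if s is K :: s' then
    (rel_basis M F K S)%:R *
      (if s' is [::] then (S == T)%:R
       else \sum_U incidence_sign S U * act F s' U T)
  else 0.

Lemma act1 F K S T : act F [:: K] S T = (rel_basis M F K S)%:R * (S == T)%:R.
Proof. by []. Qed.

Lemma act_cons F K L s S T : act F [:: K, L & s] S T =
  (rel_basis M F K S)%:R * \sum_U incidence_sign S U * act F (L :: s) U T.
Proof. by []. Qed.

Lemma act_start F K s S T :
  (rel_basis M F K S)%:R * act F (K :: s) S T = act F (K :: s) S T.
Proof. by rewrite /= mulrA; case: rel_basis; rewrite ?mul1r ?mul0r. Qed.

Lemma act2 F K L S T : act F [:: K; L] S T =
  (rel_basis M F K S)%:R * incidence_sign S T * (rel_basis M F L T)%:R.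
Proof.
rewrite act_cons (bigD1 T) //= eqxx mulr1 big1 ?addr0 ?mulrA // => U nUT.
by rewrite (negPf nUT) !mulr0.
Qed.

(** Gluing paths multiplies matrices. The basis condition at the shared flat [K] is imposed by both
    factors, which is harmless because its indicator is idempotent. *)
Lemma act_cat F s K t S T : act F (s ++ K :: t) S T =
  \sum_U act F (rcons s K) S U * act F (K :: t) U T.
Proof.
elim: s S => [|L s IH] S.
  rewrite cat0s [RHS](bigD1 S) //= eqxx mulr1 -/(act F (K :: t) S T) act_start.
  rewrite big1 ?addr0 // => U; rewrite eq_sym => nSU.
  by rewrite (negPf nSU) mulr0 mul0r.
have e : act F ((L :: s) ++ K :: t) S T = (rel_basis M F L S)%:R *
    \sum_V incidence_sign S V * act F (s ++ K :: t) V T by case: s {IH}.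
have e' U : act F (rcons (L :: s) K) S U = (rel_basis M F L S)%:R *
    \sum_V incidence_sign S V * act F (rcons s K) V U by case: s {IH e}.
rewrite e; under [RHS]eq_bigr do rewrite e' -mulrA.
rewrite -mulr_sumr; congr (_ * _); under eq_bigr do rewrite IH mulr_sumr.
rewrite exchange_big; apply: eq_bigr => U _; rewrite mulr_suml.
by apply: eq_bigr => V _; rewrite mulrA.
Qed.

Lemma act3 F K X L S T : act F [:: K; X; L] S T = (rel_basis M F K S)%:R *
  (\sum_(U | rel_basis M F X U) incidence_sign S U * incidence_sign U T) *
  (rel_basis M F L T)%:R.
Proof.
rewrite act_cons [in RHS]big_mkcond -[RHS]mulrA; congr (_ * _).
rewrite mulr_suml; apply: eq_bigr => U _; rewrite act2.
by case: rel_basis; rewrite ?mul1r ?mul0r ?mulr0 ?mulrA.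
Qed.

Lemma act_rev F s S T : act F (rev s) S T = act F s T S.
Proof.
elim: s S T => [|K [|L s] IH] S T //.
  by rewrite !act1 eq_sym; case: eqP => [->//|]; rewrite !mulr0.
rewrite !rev_cons -cats1 cat_rcons act_cat act_cons mulr_sumr.
apply: eq_bigr => U _; rewrite -rev_cons IH act2 -[in RHS]act_start (incidence_signC T U).
ring.
Qed.

(** A flat not containing [F] has no relative bases, so it cuts the path. This gives both the
    triangularity between different flats and the compatibility with the standard modules. *)
Lemma act_eq0 F K s S T : K \in s -> ~~ (F \subset K) -> act F s S T = 0.
Proof.
move=> + nFK; elim: s S => // L s IH S; rewrite inE.
case: eqP => [<- _|_ /= Ks]; first by rewrite /= /rel_basis (negPf nFK) mul0r.
case: s IH Ks => [//|L' s] IH Ks; rewrite big1 ?mulr0 // => U _.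
by rewrite IH ?mulr0.
Qed.

End Representation.
Arguments act : simpl never.

(** * The relations (FS) and wedge on the exterior algebra *)

Section RepresentationRelations.
Variables (E : finType) (M : matroid E).
Implicit Types (a : E) (F G H K L X Y : {set E}) (S T U R : {set E}).
Notation rk := (rank M).

Lemma rel_basis_card n F X K U S : rk K = (n + rk X)%N ->
  rel_basis M F X U -> rel_basis M F K S -> #|S| = (n + #|U|)%N.
Proof.
move=> e /rel_basisP[_ _ cU _] /rel_basisP[_ _ cS _].
by apply/eqP; rewrite -(eqn_add2r (rk F)) cS e -cU addnA.
Qed.

Lemma rel_basis_nsub F K L U : rel_basis M F L U -> (rk K < rk L)%N ->
  F \subset K -> ~~ (U \subset K).
Proof.
case/rel_basisP=> _ _ _ rU lt FK; apply/negP => UK.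
have /(rank_mono M) : U :|: F \subset K by rewrite subUset UK.
by rewrite rU leqNgt lt.
Qed.

(** An intermediate monomial [U] determines its flat as the closure of [U :|: F]. Summing over [X]
    and over the bases of [X] is therefore summing over all [U] of the right size, and the square of
    the boundary vanishes. *)
Lemma act_FS_down F L K S T : flat M L -> flat M K -> L \proper K ->
  rk K = (rk L).+2 ->
  \sum_(X | covered M L X && covered M X K) act M F [:: K; X; L] S T = 0.
Proof.
move=> fL fK /proper_sub LK e; under eq_bigr do rewrite act3.
rewrite -mulr_suml -mulr_sumr.
have [bS|] := boolP (rel_basis M F K S); last by rewrite !mul0r.
have [bT|] := boolP (rel_basis M F L T); last by rewrite mulr0.
rewrite mul1r mulr1; pose t U := incidence_sign S U * incidence_sign U T.
have [[FK SK cS rS] [FL TL cT rT]] := (rel_basisP _ _ _ _ bS, rel_basisP _ _ _ _ bT).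
have cST : #|S| = #|T|.+2 by apply: (rel_basis_card (n := 2) e bT bS).
pose p U := flat_closure M (U :|: F).
(* A nonzero term has the form [U = a |: T] with [a] in [K] outside [L], so that [U] is a basis of
   the flat generated by [a] and [L]. *)
have main U : #|U| = #|T|.+1 -> t U != 0 ->
    [/\ covered M L (p U), covered M (p U) K & rel_basis M F (p U) U].
  move=> cU; rewrite mulf_eq0 => /norP[].
  move=> /(incidence_sign_card (etrans cST (esym (congr1 succn cU))))[b _ eS].
  move=> /(incidence_sign_card cU)[a aT eU].
  have US : U \subset S by rewrite eS subsetUr.
  have aK : a \in K by apply: (subsetP SK); rewrite (subsetP US) // eU setU11.
  have aL : a \notin L.
    apply/negP => aL; have := rel_basis_sub bS US.
    have /(rank_mono M) : U :|: F \subset L by rewrite eU !subUset sub1set aL TL.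
    by move=> + h; rewrite h cU addSn cT ltnn.
  have /andP[c1 c2] := covered_closure fL fK LK e aK aL.
  have bU : rel_basis M F (flat_closure M (a |: L)) U.
    rewrite eU; apply: rel_basisU1 c1 bT _ aL.
    by apply: (subsetP (sub_closure _ _)); rewrite setU11.
  by rewrite /p (rel_basis_closure _ bU) ?closure_flat.
rewrite -[RHS](sum_incidence_sign0 cST) [RHS](bigID (fun U => t U != 0)) /=.
rewrite [X in _ + X]big1 ?addr0 => [|U /andP[_]]; last by rewrite negbK => /eqP.
rewrite [RHS](partition_big p (fun X => covered M L X && covered M X K)) /=; last first.
  by move=> U /andP[/eqP cU tU]; have [-> ->] := main U cU tU.
apply: eq_bigr => X /andP[c1 c2]; rewrite [LHS]big_mkcond [RHS]big_mkcond /=.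
apply: eq_bigr => U _; have [tU|] := eqVneq (t U) 0.
  by rewrite /= andbF /= -/(t U) tU; case: ifP.
rewrite andbT => tU; have [fX rX] : flat M X /\ rk X = (rk L).+1 by have /coveredP[] := c1.
case: ifP => [bU|/negbT nbU].
  rewrite (rel_basis_card (n := 1) rX bT bU) add1n eqxx.
  by rewrite /p (rel_basis_closure fX bU) eqxx.
case: eqP => //= cU; case: eqP => // pU.
by have [_ _] := main U cU tU; rewrite pU (negPf nbU).
Qed.

Lemma act_FS_up F L K S T : flat M L -> flat M K -> L \proper K ->
  rk K = (rk L).+2 ->
  \sum_(X | covered M L X && covered M X K) act M F [:: L; X; K] S T = 0.
Proof.
move=> fL fK LK e; rewrite -[RHS](act_FS_down F T S fL fK LK e).
by apply: eq_bigr => X _; rewrite -act_rev.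
Qed.

(** On the diagonal each [a] in [L :\: K] is inserted and deleted again, contributing the square of
    a sign. Off the diagonal, [a |: S = b |: T] would put the basis of [L] inside [K]. *)
Lemma act_wedge_eq F K L S T : covered M K L ->
  act M F [:: K; L; K] S T = act M F [:: K] S T *+ #|L :\: K|.
Proof.
move=> cKL; rewrite act3 act1.
have [bS|] := boolP (rel_basis M F K S); last by rewrite !mul0r mul0rn.
have [bT|nbT] := boolP (rel_basis M F K T); last first.
  by rewrite mulr0; case: eqP nbT => [<-|]; rewrite ?bS // mulr0 mul0rn.
rewrite !mul1r mulr1.
have [[FK SK cS rS] [_ TK cT rT]] := (rel_basisP _ _ _ _ bS, rel_basisP _ _ _ _ bT).
have [fK fL KL rL] := coveredP _ _ _ cKL.
have nLK U : rel_basis M F L U -> ~~ (U \subset K).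
  by move=> bU; rewrite (rel_basis_nsub bU) ?rL.
have [eST|nST] := eqVneq S T; last first.
  rewrite mul0rn big1 // => U bU; apply/eqP; apply: contraNT (nLK U bU) => nz.
  move: nz; rewrite mulf_eq0 incidence_signC => /norP[].
  have cUS : #|U| = #|S|.+1 := rel_basis_card (n := 1) rL bS bU.
  have cUT : #|U| = #|T|.+1 := rel_basis_card (n := 1) rL bT bU.
  move=> /(incidence_sign_card cUS)[a aS eU] /(incidence_sign_card cUT)[b bT' eU'].
  rewrite eU subUset SK sub1set andbT; apply: (subsetP TK).
  have : a \in b |: T by rewrite -eU' eU setU11.
  rewrite !inE => /predU1P[eab|//]; case/eqP: nST.
  have : a |: S = a |: T by rewrite -eU eU' eab.
  move/setP => h; apply/setP => x; have := h x; rewrite !inE.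
  by case: eqP => // ->; rewrite (negPf aS) eab (negPf bT').
rewrite -{T bT cT rT TK}eST.
have inj : {in L :\: K &, injective (fun a => a |: S)}.
  move=> a b; rewrite !inE => /andP[aK aL] /andP[bK bL] /setP/(_ a).
  rewrite !inE eqxx /= => /esym/predU1P[//|/(subsetP SK)].
  by rewrite (negPf aK).
transitivity (\sum_(U in [set a |: S | a in L :\: K])
    incidence_sign S U * incidence_sign U S).
  rewrite [LHS]big_mkcond [RHS]big_mkcond; apply: eq_bigr => U _.
  case: imsetP => [[a]|nU].
    rewrite inE => /andP[aK aL] ->; rewrite (rel_basisU1 cKL bS aL aK) //.
  case: ifP => // bU; apply/eqP; apply: contraT; rewrite mulf_eq0 => /norP[_].
  have [_ UL _ _] := rel_basisP _ _ _ _ bU.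
  have cUS : #|U| = #|S|.+1 := rel_basis_card (n := 1) rL bS bU.
  move=> /(incidence_sign_card cUS)[a aS eU]; case: nU; exists a => //.
  rewrite inE; move: UL (nLK U bU); rewrite eU !subUset !sub1set SK andbT => /andP[-> _].
  by move=> ->.
rewrite big_imset //= -sumr_const; apply: eq_bigr => a; rewrite inE => /andP[aK _].
have aS : a \notin S by apply: contra aK; apply: (subsetP SK).
by rewrite incidence_signC incidence_signU1 // insertion_sign_sqr.
Qed.

Lemma incidence_sign_union S T U : S != T -> #|U| = #|S|.+1 -> #|U| = #|T|.+1 ->
  incidence_sign S U * incidence_sign U T != 0 -> U = S :|: T.
Proof.
move=> nST cS cT; rewrite mulf_eq0 incidence_signC => /norP[].
move=> /(incidence_sign_card cS)[a aS eU] /(incidence_sign_card cT)[b bT eU'].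
apply/eqP; rewrite eq_sym eqEcard subUset {1}eU {1}eU' !subsetUr /=.
rewrite cS; apply: proper_card; rewrite properE subsetUl subUset subxx /=.
apply: contraNN nST => TS; by rewrite eq_sym eqEcard TS -ltnS -cS cT leqnn.
Qed.

Lemma incidence_sign_inter S T R : S != T -> #|S| = #|R|.+1 -> #|T| = #|R|.+1 ->
  incidence_sign S R * incidence_sign R T != 0 -> R = S :&: T.
Proof.
move=> nST cS cT; rewrite mulf_eq0 (incidence_signC R) => /norP[].
move=> /(incidence_sign_card cS)[a aS eS] /(incidence_sign_card cT)[b bT eT].
apply/eqP; rewrite eqEcard subsetI {1}eS {1}eT !subsetUr /=.
rewrite -ltnS -cS; apply: proper_card; rewrite properE subsetIl subsetI subxx /=.
apply: contraNN nST => ST; by rewrite eqEcard ST cT cS leqnn.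
Qed.

(** Creation and annihilation operators of distinct elements anticommute: with [S = a |: R] and
    [T = b |: R], either [b] is inserted before [a] is deleted, or the other way round. *)
Lemma incidence_sign_square S T : #|S| = #|T| -> #|S| = #|S :&: T|.+1 ->
  incidence_sign S (S :|: T) * incidence_sign (S :|: T) T =
  - (incidence_sign S (S :&: T) * incidence_sign (S :&: T) T).
Proof.
set R := S :&: T => e cS; have cT : #|T| = #|R|.+1 by rewrite -e.
have [a eD] : exists a, S :\: R = [set a].
  apply/cards1P; have := cardsID R S; rewrite (setIidPr (subsetIl S T)) cS => /eqP.
  by rewrite -addn1 eqn_add2l => /eqP->.
have [b eD'] : exists b, T :\: R = [set b].
  apply/cards1P; have := cardsID R T; rewrite (setIidPr (subsetIr S T)) cT => /eqP.
  by rewrite -addn1 eqn_add2l => /eqP->.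
have aD : a \in S :\: R by rewrite eD set11.
have bD : b \in T :\: R by rewrite eD' set11.
have eS : S = a |: R by rewrite -(setID S R) (setIidPr (subsetIl S T)) eD setUC.
have eT : T = b |: R by rewrite -(setID T R) (setIidPr (subsetIr S T)) eD' setUC.
have [aR bR] : a \notin R /\ b \notin R.
  by move: aD bD; rewrite !in_setD => /andP[-> _] /andP[-> _].
have ab : a != b.
  apply: contraTneq (aD) => ab; rewrite inE negb_and negbK /R inE eT.
  by rewrite eS -ab !setU11.
have aT : a \notin b |: R by rewrite !in_setU1 (negPf ab).
have bS : b \notin a |: R by rewrite !in_setU1 eq_sym (negPf ab).
have eU1 : S :|: T = b |: (a |: R) by rewrite eS eT setUCA -setUA setUid.
have eU2 : S :|: T = a |: (b |: R) by rewrite eU1 setUCA.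
rewrite {1}eU1 eU2 (incidence_signC R) eS eT incidence_signC !incidence_signU1 //.
have xy := insertion_sign_anticomm ab aR bR.
have zz := insertion_sign_sqr b (a |: R); have yy := insertion_sign_sqr b R.
set x := insertion_sign a (b |: R) in xy *; set z := insertion_sign b (a |: R) in xy zz *.
set y := insertion_sign b R in xy yy *; set w := insertion_sign a R in xy *.
have -> : z * x = z * (x * y) * y by rewrite -mulrA -(mulrA x) yy mulr1.
by rewrite xy mulrN mulNr mulrA zz mul1r.
Qed.

(** If [S] and [T] differ by exchanging one element, then [S :&: T] is independent modulo [F], which
    forces [K :&: K'] to be covered by [K], and the claim is the anticommutation
    [incidence_sign_square]. Otherwise both sides vanish. *)
Lemma act_wedge_neq F K L K' S T : covered M K L -> covered M K' L -> K != K' ->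
  act M F [:: K; L; K'] S T =
  if covered M (K :&: K') K then - act M F [:: K; K :&: K'; K'] S T else 0.
Proof.
move=> cKL cK'L nKK'; set G := K :&: K'; rewrite !act3.
have [bS|] := boolP (rel_basis M F K S); last by rewrite !mul0r oppr0 if_same.
have [bT|] := boolP (rel_basis M F K' T); last by rewrite !mulr0 oppr0 if_same.
rewrite !mul1r !mulr1.
have [[fK fL KL rL] [fK' _ K'L rL']] := (coveredP _ _ _ cKL, coveredP _ _ _ cK'L).
have rKK' : rk K = rk K' by apply/eqP; rewrite -eqSS -rL rL'.
have cST : #|S| = #|T| := rel_basis_card (n := 0) rKK' bT bS.
have nST : S != T.
  apply: contraNneq nKK' => eST.
  by rewrite -(rel_basis_closure fK bS) -(rel_basis_closure fK' bT) eST.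
have [[FK SK cS rS] [FK' TK' cT rT]] := (rel_basisP _ _ _ _ bS, rel_basisP _ _ _ _ bT).
have FG : F \subset G by rewrite subsetI FK.
have fG : flat M G by apply: flatI.
have ltGK : (rk G < rk K)%N.
  apply: flat_proper_rank => //; rewrite properE subsetIl subsetI subxx /=.
  by apply: contra nKK' => KK'; apply/eqP/esym/(flat_rank_eq fK); rewrite // rKK'.
(* Both sides reduce to a single term, at [S :|: T] resp. [S :&: T]. *)
transitivity ((rel_basis M F L (S :|: T))%:R *
    (incidence_sign S (S :|: T) * incidence_sign (S :|: T) T)).
  rewrite big_mkcond (bigD1 (S :|: T)) //= big1 ?addr0 => [|U nU].
    by case: ifP; rewrite ?mul1r ?mul0r.
  case: ifP => // bU; apply/eqP; apply: contraNT nU => nz; apply/eqP.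
  apply: incidence_sign_union nz => //.
    exact: (rel_basis_card (n := 1) rL bS bU).
  exact: (rel_basis_card (n := 1) rL' bT bU).
have [cI|nI] := eqVneq #|S| #|S :&: T|.+1; last first.
  have z1 : incidence_sign S (S :&: T) = 0.
    apply/eqP; apply: contraNT nI => /incidence_sign_neq0[] [a].
      by move=> aI eS; rewrite {1}eS cardsU1 aI.
    by move=> aS /setP/(_ a); rewrite !inE eqxx (negPf aS).
  have z2 : incidence_sign S (S :|: T) = 0.
    apply/eqP; apply: contraNT nI => /incidence_sign_neq0[] [a].
      move=> aU /setP/(_ a); rewrite !inE eqxx /=; move: aU.
      by rewrite !inE negb_or => /andP[/negPf->].
    move=> aS eU; have := cardsUI S T; rewrite eU cardsU1 aS -cST add1n addSnnS => /eqP.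
    by rewrite eqn_add2l => /eqP->.
  rewrite z2 mul0r mulr0; case: ifP => // cG; rewrite big1 ?oppr0 // => R bR.
  apply/eqP; apply: contraT => nz.
  have eR : R = S :&: T.
    apply: incidence_sign_inter nz => //.
      exact: (rel_basis_card (n := 1) (covered_rank cG) bR bS).
    by rewrite -cST; exact: (rel_basis_card (n := 1) (covered_rank cG) bR bS).
  by rewrite eR z1 mul0r eqxx in nz.
have rI : rk ((S :&: T) :|: F) = (#|S :&: T| + rk F)%N.
  by apply: rel_basis_sub bS _; apply: subsetIl.
have IG : S :&: T \subset G by rewrite setISS.
have rG : rk K = (rk G).+1.
  apply/eqP; rewrite eqn_leq ltGK andbT -cS cI addSn ltnS -rI rank_mono //.
  by rewrite subUset IG.
have -> : covered M G K by apply/coveredP; split=> //; apply: subsetIl.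
have bI : rel_basis M F G (S :&: T).
  have e : rk G = (#|S :&: T| + rk F)%N by apply/eqP; rewrite -eqSS -rG -cS cI.
  by apply/rel_basisP; rewrite rI e.
(* The closure of [S :|: T :|: F] contains the two distinct flats [K] and [K'] of equal rank, so its
   rank exceeds theirs and reaches that of [L]. *)
have bU : rel_basis M F L (S :|: T).
  have sU : S :|: T :|: F \subset L.
    by rewrite !subUset (subset_trans SK KL) (subset_trans TK' K'L) (subset_trans FK KL).
  have eU : (#|S :|: T| + rk F = rk L)%N.
    apply/eqP; rewrite rL -cS -addSn eqn_add2r -(eqn_add2r #|S :&: T|) cardsUI.
    by rewrite -cST addSnnS -cI.
  apply/rel_basisP; split=> //.
  - exact: subset_trans FK KL.
  - by rewrite subUset (subset_trans SK KL) (subset_trans TK' K'L).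
  apply/eqP; rewrite eqn_leq rank_mono //= rL -(rank_closure M (S :|: T :|: F)).
  set C := flat_closure M _; have sC := sub_closure M (S :|: T :|: F).
  have KC : K \subset C.
    rewrite -(rel_basis_closure fK bS) closure_min ?closure_flat //.
    by apply: subset_trans sC; rewrite setUAC subsetUl.
  have K'C : K' \subset C.
    rewrite -(rel_basis_closure fK' bT) closure_min ?closure_flat //.
    by apply: subset_trans sC; rewrite -setUA subsetUr.
  apply: flat_proper_rank => //; rewrite properE KC /=.
  apply: contra nKK' => CK; apply/eqP/(flat_rank_eq fK'); last by rewrite rKK'.
  exact: subset_trans K'C CK.
rewrite bU mul1r big_mkcond (bigD1 (S :&: T)) //= bI big1 ?addr0 => [|R nR].
  exact: incidence_sign_square.
case: ifP => // bR; apply/eqP; apply: contraNT nR => nz; apply/eqP.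
have cR := rel_basis_card (n := 1) rG bR bS.
by apply: incidence_sign_inter nz => //; rewrite -cST.
Qed.
End RepresentationRelations.

(** * The induced representation of S(M) *)

Section RepresentationOfS.
Variables (E : finType) (M : matroid E).
Implicit Types (F G H K L X Y : {set E}) (S T U : {set E}) (s t : seq {set E}).
Implicit Types (p q : flag_path M).
Notation rk := (rank M).

Lemma act_end F K s S U : ~~ rel_basis M F K U -> act M F (rcons s K) S U = 0.
Proof.
by move=> nb; rewrite -act_rev rev_rcons -act_start (negPf nb) mul0r.
Qed.

Definition path_alg_act F S T (a : path_alg M) : int :=
  linext (V := int^o) (fun p : flag_path M => act M F p S T : int^o) a.

Lemma path_alg_act_is_linear F S T :
  linear (path_alg_act F S T : path_alg M -> int^o).
Proof. exact: linext_is_linear. Qed.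

Lemma path_alg_actB F S T : {morph path_alg_act F S T : a b / a - b}.
Proof. exact: (linearB (linext (V := int^o) _)). Qed.

Lemma path_alg_act_sum F S T (I : finType) (P : pred I) (f : I -> path_alg M) :
  path_alg_act F S T (\sum_(i | P i) f i) = \sum_(i | P i) path_alg_act F S T (f i).
Proof. exact: (linear_sum (linext (V := int^o) _)). Qed.

Lemma path_alg_act_path F S T s : is_flag_path M s ->
  path_alg_act F S T (path_elt M s) = act M F s S T.
Proof. by move=> sP; rewrite (path_eltI sP) /path_alg_act linextU. Qed.

Lemma path_alg_act0 F S T : path_alg_act F S T 0 = 0.
Proof. by rewrite -(subrr 0) path_alg_actB subrr. Qed.

Lemma path_alg_actM F S T (a b : path_alg M) : path_alg_act F S T (a * b) =
  \sum_U path_alg_act F S U a * path_alg_act F U T b.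
Proof.
suff E1 p q : path_alg_act F S T (path_mul << p >> << q >>) =
    \sum_U path_alg_act F S U << p >> * path_alg_act F U T << q >>.
  have E0 p b' : path_alg_act F S T (path_mul << p >> b') =
      \sum_U path_alg_act F S U << p >> * path_alg_act F U T b'.
    apply: (malg_lin_ext (V := int^o)
      (f := fun b => path_alg_act F S T (path_mul << p >> b))
      (g := fun b => \sum_U path_alg_act F S U << p >> * path_alg_act F U T b)) b' => //.
      by move=> c u v; rewrite path_mul_linr path_alg_act_is_linear.
    move=> c u v; rewrite scaler_sumr -big_split /=; apply: eq_bigr => U _.
    by rewrite path_alg_act_is_linear mulrDr /GRing.scale /= mulrCA.
  apply: (malg_lin_ext (V := int^o) (f := fun a => path_alg_act F S T (path_mul a b))
    (g := fun a => \sum_U path_alg_act F S U a * path_alg_act F U T b)) a => //.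
    by move=> c u v; rewrite path_mul_linl path_alg_act_is_linear.
  move=> c u v; rewrite scaler_sumr -big_split /=; apply: eq_bigr => U _.
  by rewrite path_alg_act_is_linear mulrDl /GRing.scale /= mulrA.
rewrite path_mulUU.
have -> : \sum_U path_alg_act F S U << p >> * path_alg_act F U T << q >> =
    \sum_U act M F p S U * act M F q U T.
  by apply: eq_bigr => U _; rewrite /path_alg_act !linextU.
have [K [s [ep fK Ks]]] := flag_path_cons p.
have [L [t [eq fL Lt]]] := flag_path_cons q.
have eend : (p : seq _) = rcons (belast K s) (path_end p).
  by rewrite /path_end ep -lastI.
have fe : flat M (path_end p) by rewrite /path_end ep; apply: path_flat Ks.
have [e|ne] := eqVneq (path_end p) (path_start q).
  rewrite path_concatE /path_alg_act linextU /= eq /=.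
  have -> : p ++ t = belast K s ++ L :: t.
    by rewrite {1}eend e eq /path_start /= cat_rcons.
  by rewrite act_cat {1}eend e eq.
rewrite path_concatN // path_alg_act0 big1 // => U _.
(* Paths that do not compose also have product zero as matrices, since a monomial [U] is a basis of
   only one flat, the closure of [U :|: F]. *)
have [bU|nbU] := boolP (rel_basis M F (path_end p) U); last first.
  by rewrite eend act_end ?mul0r.
rewrite eq -act_start (negPf (_ : ~~ rel_basis M F L U)) ?mul0r ?mulr0 //.
apply: contra ne => bU'; rewrite /path_start eq /=.
by rewrite -(rel_basis_closure fe bU) (rel_basis_closure fL bU').
Qed.

Lemma path_alg_act_rel F S T x : S_relation x -> path_alg_act F S T x = 0.
Proof.
case=> [L K fL fK LK e|L K fL fK LK e|K L K' cKL cK'L].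
- rewrite path_alg_act_sum -[RHS](act_FS_up F S T fL fK LK e).
  apply: eq_bigr => X /andP[c1 c2]; rewrite path_alg_act_path //=.
  by rewrite fL /adjacent c1 c2.
- rewrite path_alg_act_sum -[RHS](act_FS_down F S T fL fK LK e).
  apply: eq_bigr => X /andP[c1 c2]; rewrite path_alg_act_path //=.
  by rewrite fK /adjacent c1 c2 !orbT.
have fK : flat M K by have /covered_flat/andP[] := cKL.
rewrite path_alg_actB path_alg_act_path; last by rewrite /= fK /adjacent cKL cK'L !orbT.
apply/eqP; rewrite subr_eq0; apply/eqP; rewrite /wedge_value.
have [eK|nK] := eqVneq K K'.
  rewrite -{K' cK'L}eK act_wedge_eq // -[#|_|]sum1_card -!sumrMnr path_alg_act_sum.
  by apply: eq_bigr => a _; rewrite mulr1n path_alg_act_path //= fK.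
rewrite act_wedge_neq //; case: ifP => cG; last by rewrite path_alg_act0.
rewrite -[- path_elt M _]add0r path_alg_actB path_alg_act0 add0r path_alg_act_path //=.
rewrite fK /adjacent cG orbT /= andbT; apply/orP; left.
have [fG _ _ rG] := coveredP _ _ _ cG; have [fK' _ _ _] := coveredP _ _ _ cK'L.
apply/coveredP; split; rewrite ?subsetIr //.
have [_ _ _ e] := coveredP _ _ _ cKL; have [_ _ _ e'] := coveredP _ _ _ cK'L.
by rewrite -rG; apply/eqP; rewrite -eqSS -e -e'.
Qed.

(** The elements acting by the zero matrix form a two-sided ideal. All entries are required to
    vanish at once, because a product mixes them. *)
Lemma path_alg_act_ideal F S T x : x \in ideal_gen (@S_relation E M) ->
  path_alg_act F S T x = 0.
Proof.
move=> /asboolP/(_ (fun x => `[< forall S T, path_alg_act F S T x = 0 >])) h.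
suff /asboolP : `[< forall S T, path_alg_act F S T x = 0 >] by apply.
apply: h => [|y yR]; last by apply/asboolP => S' T'; apply: path_alg_act_rel.
split=> [|a u /asboolP hu|a u /asboolP hu]; last 2 first.
- by apply/asboolP => S' T'; rewrite path_alg_actM big1 // => U _; rewrite hu mulr0.
- by apply/asboolP => S' T'; rewrite path_alg_actM big1 // => U _; rewrite hu mul0r.
split=> [|u v /asboolP hu /asboolP hv]; apply/asboolP => S' T'.
  exact: path_alg_act0.
by rewrite path_alg_actB hu hv subrr.
Qed.

Definition S_act F S T (x : Defs.S M) : int :=
  path_alg_act F S T (repr (x : Quotient.quot (ideal_gen (@S_relation E M)))).

Lemma S_act_pi F S T a :
  S_act F S T (ring_quot_pi (@S_relation E M) a) = path_alg_act F S T a.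
Proof.
apply/eqP; rewrite -subr_eq0 -path_alg_actB; apply/eqP/path_alg_act_ideal.
by rewrite Quotient.idealrBE reprK.
Qed.

Lemma S_act_is_zmod_morphism F S T : zmod_morphism (S_act F S T).
Proof.
move=> x y; have [a ->] := ring_quot_piP x; have [b ->] := ring_quot_piP y.
rewrite !S_act_pi -path_alg_actB -S_act_pi; congr (S_act _ _ _ _).
by apply/eqP; rewrite subr_eq -ring_quot_piD subrK.
Qed.
HB.instance Definition _ F S T := GRing.isZmodMorphism.Build (Defs.S M) int
  (S_act F S T) (S_act_is_zmod_morphism F S T).

Lemma S_actM F S T x y :
  S_act F S T (x * y) = \sum_U S_act F S U x * S_act F U T y.
Proof.
have [a ->] := ring_quot_piP x; have [b ->] := ring_quot_piP y.
rewrite [_ * _]ring_quot_piM S_act_pi path_alg_actM.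
by apply: eq_bigr => U _; rewrite !S_act_pi.
Qed.

Lemma S_act_path F S T s : is_flag_path M s ->
  S_act F S T (S_path M s) = act M F s S T.
Proof. by move=> sP; rewrite S_act_pi path_alg_act_path. Qed.

End RepresentationOfS.

(** * Spanning and independence of flags *)

Section NbcFlags.
Variables (E : finType) (M : matroid E).
Implicit Types (a : E) (F G H K L X Y : {set E}) (S T U : {set E}).
Implicit Types (s t c d : seq {set E}).
Notation rk := (rank M).

(** The relation (FS) for an arbitrary function of descending flags. The straightening argument then
    applies equally to flags with other factors around them and to reversed flags. *)
Definition FS_null (V : zmodType) (h : seq {set E} -> V) : Prop :=
  forall s L K t, flat M L -> flat M K -> L \proper K -> rk K = (rk L).+2 ->
  \sum_(X | covered M L X && covered M X K) h (s ++ [:: K, X, L & t]) = 0.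

Lemma FS_null_cons (V : zmodType) (h : seq {set E} -> V) K :
  FS_null h -> FS_null (fun c => h (K :: c)).
Proof. by move=> nh s L K' t fL fK LK e; apply: (nh (K :: s)). Qed.

Lemma flag_to_cons F K X c :
  flag_to M F K (X :: c) = covered M X K && flag_to M F X c.
Proof. by rewrite /flag_to /= andbA. Qed.

(* If [a] lies in the second flat of the flag, first move the place where [a]   *)
(* disappears one step up: for [K > X > Y] with [a] in [X] but not in [Y], the   *)
(* relation (FS) at [K > Y] has [X] as its only term containing [a].             *)
Lemma flag_avoid_span (V : zmodType) (U : zmodClosed V) (h : seq {set E} -> V)
    F K c a : FS_null h -> flag_to M F K c -> a \in K -> a \notin F ->
  (forall X c', covered M X K -> a \notin X -> flag_to M F X c' ->
    h [:: K, X & c'] \in U) ->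
  h (K :: c) \in U.
Proof.
move=> + + + aF; elim: c K h => [|X c IH] K h nh.
  by rewrite /flag_to /= => /eqP->; rewrite (negPf aF).
rewrite flag_to_cons => /andP[cXK Xc] aK hU.
have [aX|aX] := boolP (a \in X); last exact: hU.
apply: (IH X (fun c => h (K :: c))) => // [|Y c' cYX aY Yc']; first exact: FS_null_cons.
have [fX fK XK rK] := coveredP _ _ _ cXK; have [fY _ YX rX] := coveredP _ _ _ cYX.
have YK : Y \proper K.
  by apply/properP; split; [apply: subset_trans YX XK | exists a].
have := nh [::] Y K c' fY fK YK; rewrite rK rX => /(_ erefl).
rewrite (bigD1 X) /= ?cYX // => /eqP; rewrite addr_eq0 => /eqP->.
rewrite rpredN rpred_sum // => X' /andP[/andP[cYX' cX'K] nX'].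
apply: hU; rewrite ?flag_to_cons ?cYX' //.
apply: contra nX' => aX'; apply/eqP.
by rewrite (covered_eq_closure cYX' aX' aY) (covered_eq_closure cYX aX aY).
Qed.

(** Once the first step avoids the chosen element, the top flat is absorbed into [h] and the rest of
    the flag is straightened in the same way. *)
Lemma nbc_flags_span (V : zmodType) (U : zmodClosed V) (h : seq {set E} -> V)
    F K n c : FS_null h -> flag_to M F K c -> size c = n ->
  {in nbc_flags M F n K, forall d, h d \in U} -> h (K :: c) \in U.
Proof.
elim: n K c h => [|n IH] K c h nh.
  move=> + /size0nil e; rewrite e /flag_to /= => /eqP-> /(_ [:: F]).
  by rewrite eqxx inE eqxx => /(_ isT).
move=> Kc sc hU; have FK := flag_to_sub Kc; have rK := flag_to_rank Kc.
have [a aKF] : exists a, a \in K :\: F.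
  apply/set0Pn; rewrite setD_eq0; apply/negP => /(rank_mono M).
  by rewrite rK sc addSn ltnNge leq_addl.
move: hU => /=; rewrite /avoids; case: pickP => [{aKF}a|/(_ a)]; last by rewrite /= aKF.
rewrite !inE => /andP[aF aK] hU.
apply: (flag_avoid_span nh Kc aK aF) => X c' cXK aX Xc'.
apply: (IH X c' (fun c => h (K :: c))) => //; first exact: FS_null_cons.
  have := covered_rank cXK; rewrite rK sc (flag_to_rank Xc') addSn.
  by move=> [] /eqP; rewrite eqn_add2r => /eqP.
move=> d dX; apply: hU; apply/allpairsPdep; exists X, d; split=> //.
by rewrite mem_filter cXK aX (flag_to_sub Xc') mem_index_enum.
Qed.

(* Against the monomials [a |: T], where [a] is the element avoided at [K] and   *)
(* [T] a basis of [X], only the flags [K > X > ..] contribute.                   *)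
Lemma nbc_flags_free F n K (z : seq {set E} -> int) : flat M F -> flat M K ->
  F \subset K -> rk K = (n + rk F)%N ->
  (forall S, \sum_(d <- nbc_flags M F n K) z d * act M F d S set0 = 0) ->
  {in nbc_flags M F n K, forall d, z d = 0}.
Proof.
move=> fF; elim: n K z => [|n IH] K z fK FK rK.
  have -> : K = F by apply: (@flat_rank_eq _ M) => //; rewrite rK.
  rewrite /= eqxx => /(_ set0) + d; rewrite big_seq1 inE => + /eqP->.
  by rewrite act1 rel_basisFF eqxx !mulr1.
have [a aKF] : exists a, a \in K :\: F.
  apply/set0Pn; rewrite setD_eq0; apply/negP => /(rank_mono M).
  by rewrite rK addSn ltnNge leq_addl.
rewrite /= /avoids; case: pickP => [{aKF}a|/(_ a)]; last by rewrite /= aKF.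
rewrite !inE => /andP[aF aK] h d /allpairsPdep[X [d' [+ d'X ->]]].
rewrite mem_filter => /andP[/and3P[cXK FX aX] _].
have [fX _ XK rXK] := coveredP _ _ _ cXK.
apply: (IH X (fun d => z (K :: d)) fX FX _ _ d' d'X) => [|T].
  by apply/eqP; rewrite -eqSS -rXK rK.
have [bT|nbT] := boolP (rel_basis M F X T); last first.
  rewrite big_seq big1 // => d1 /nbc_flagsP[c [-> _ _]].
  by rewrite -act_start (negPf nbT) mul0r mulr0.
have TX : T \subset X by case/rel_basisP: bT.
have aT : a \notin T by apply: contra aX; apply: (subsetP TX).
have bS := rel_basisU1 cXK bT aK aX.
(* A basis of [Y] cannot contain [a], so the only one obtained from [a |: T] by deleting an element
   is [T] itself. *)
have key Y d1 : covered M Y K -> a \notin Y -> d1 \in nbc_flags M F n Y ->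
    act M F (K :: d1) (a |: T) set0 = insertion_sign a T * act M F d1 T set0.
  move=> cYK aY /nbc_flagsP[c [-> _ _]]; rewrite act_cons bS mul1r.
  have st V := act_start M F Y c V set0.
  move: {c}(act M F (Y :: c)) st => f st; rewrite (bigD1 T) //=.
  rewrite incidence_signU1 // big1 ?addr0 // => V nVT; rewrite -st.
  have [bV|] := boolP (rel_basis M F Y V); last by rewrite mul0r mulr0.
  apply/eqP; rewrite mulf_eq0; apply/orP; left; apply: contraNT nVT.
  have cV : #|a |: T| = #|V|.+1 := rel_basis_card (n := 1) (covered_rank cYK) bV bS.
  have aV : a \notin V.
    by apply: contra aY; apply: (subsetP _); case/rel_basisP: bV.
  move=> /(incidence_sign_card cV)[b bV' e].
  have : a \in b |: V by rewrite -e setU11.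
  rewrite in_setU1 (negPf aV) orbF => /eqP ab.
  by rewrite -(setU1K bV') -e -ab setU1K.
have := h (a |: T); rewrite big_allpairs_dep big_filter /= (bigD1 X) /=; last first.
  by rewrite cXK FX.
rewrite [X in _ + X]big1 ?addr0 => [e|Y /andP[/and3P[cYK FY aY] nYX]]; last first.
  rewrite big_seq big1 // => d1 d1Y; rewrite (key Y) //.
  have [c [-> _ _]] := nbc_flagsP d1Y.
  rewrite -act_start; have [bT'|] := boolP (rel_basis M F Y T); last first.
    by rewrite mul0r !mulr0.
  have [fY _ _ _] := coveredP _ _ _ cYK.
  by case/eqP: nYX; rewrite -(rel_basis_closure fY bT') (rel_basis_closure fX bT).
suff : insertion_sign a T * \sum_(d <- nbc_flags M F n X) z (K :: d) * act M F d T set0 = 0.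
  move/eqP; rewrite mulf_eq0 => /predU1P[z0|/eqP//].
  by have := insertion_sign_sqr a T; rewrite z0 mul0r.
rewrite -[RHS]e mulr_sumr [LHS]big_seq [RHS]big_seq; apply: eq_bigr => d1 d1X.
by rewrite (key X) // mulrCA.
Qed.

(** A flag is listed with both its ends, so one of size $m+1$ has degree $m$. This is the $-1$ in
    later exponents. *)
Definition standard_flags F : seq (seq {set E}) :=
  [seq d | K <- [seq K <- index_enum {set E} | flat M K && (F \subset K)],
           d <- nbc_flags M F (rk K - rk F) K].

Lemma mem_standard_flags F K c d : flat M F -> flag_to M F K c ->
  d \in nbc_flags M F (size c) K -> d \in standard_flags F.
Proof.
move=> fF Kc dK; apply/allpairsPdep; exists K, d; split=> //.
  by rewrite mem_filter (flag_to_flat fF Kc) (flag_to_sub Kc) mem_index_enum.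
by rewrite (flag_to_rank Kc) addnK.
Qed.

Lemma standard_flagsP F d : d \in standard_flags F ->
  exists K c, [/\ d = K :: c, flag_to M F K c & flat M K].
Proof.
case/allpairsPdep=> K [d' [+ /nbc_flagsP[c [-> Kc _]] ->]].
by rewrite mem_filter => /andP[/andP[fK _] _]; exists K, c.
Qed.

Lemma uniq_standard_flags F : uniq (standard_flags F).
Proof.
apply: allpairs_uniq_dep; first exact: filter_uniq (index_enum_uniq _).
  by move=> K _; apply: uniq_nbc_flags.
move=> [K c] [L d] /allpairsPdep[K' [c' [_ /nbc_flagsP[c1 [-> _ _]] [-> ->]]]].
move=> /allpairsPdep[L' [d' [_ /nbc_flagsP[d1 [-> _ _]] [-> ->]]]].
by case=> <- <-.
Qed.

(** A row [S] is a basis of a single flat, hence sees only the flags starting there. *)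
Lemma standard_flags_free F (z : seq {set E} -> int) : flat M F ->
  (forall S, \sum_(d <- standard_flags F) z d * act M F d S set0 = 0) ->
  {in standard_flags F, forall d, z d = 0}.
Proof.
move=> fF h d /allpairsPdep[K [d' [+ dK ->]]] {d}.
rewrite mem_filter => /andP[/andP[fK FK] _].
apply: (nbc_flags_free fF fK FK _ _ dK) => [|S].
  by rewrite subnK // rank_mono.
have [bS|nbS] := boolP (rel_basis M F K S); last first.
  rewrite big_seq big1 // => d1 /nbc_flagsP[c [-> _ _]].
  by rewrite -act_start (negPf nbS) mul0r mulr0.
have := h S; rewrite big_allpairs_dep big_filter /= (bigD1 K) /= ?fK //.
rewrite [X in _ + X]big1 ?addr0 // => L /andP[/andP[fL FL] nLK].
rewrite big_seq big1 // => d1 /nbc_flagsP[c [-> _ _]].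
rewrite -act_start; have [bS'|] := boolP (rel_basis M F L S); last by rewrite mul0r mulr0.
by case/eqP: nLK; rewrite -(rel_basis_closure fK bS) (rel_basis_closure fL bS').
Qed.

End NbcFlags.

(** * Normal form in S(M) *)

Section RingQuotientMorphism.
Variables (R : pzRingType) (X : R -> Prop).

Lemma ring_quot_pi_is_zmod_morphism : zmod_morphism (ring_quot_pi X).
Proof. by move=> x y; apply/eqP; rewrite eq_sym subr_eq -ring_quot_piD subrK. Qed.
HB.instance Definition _ := GRing.isZmodMorphism.Build R (ring_quot X)
  (ring_quot_pi X) ring_quot_pi_is_zmod_morphism.

Lemma ring_quot_pi_rel x : X x -> ring_quot_pi X x = 0.
Proof.
move=> Xx; rewrite -(raddf0 (ring_quot_pi X)); apply/eqP.
by rewrite -Quotient.idealrBE subr0; apply/asboolP => I _; apply.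
Qed.
End RingQuotientMorphism.

Section SpanningS.
Variables (E : finType) (M : matroid E).
Implicit Types (F G H K L X Y : {set E}) (s t c d : seq {set E}).
Implicit Types (p q : flag_path M) (x y : Defs.S M).
Notation rk := (rank M).

Lemma is_flag_path_cat s K t : is_flag_path M (s ++ K :: t) =
  is_flag_path M (rcons s K) && is_flag_path M (K :: t).
Proof.
case: s => [|L s] /=; first by rewrite andbT; case: (flat M K).
rewrite cat_path rcons_path /= -!andbA; case fL: (flat M L) => //=.
case pLs: (path _ L s) => //=; case aLK: (adjacent _ _ _) => //=.
have := path_flat fL (_ : path (adjacent M) L (rcons s K)).
by rewrite rcons_path pLs aLK last_rcons => ->.
Qed.

Lemma is_flag_path_cons K L s : is_flag_path M [:: K, L & s] =
  [&& flat M K, adjacent M K L & is_flag_path M (L :: s)].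
Proof. by rewrite -[_ :: _ :: _]cat1s is_flag_path_cat /= andbT -andbA. Qed.

(** No assumption of being a flag path is made: if the whole sequence is not one, then one of the
    two pieces is not, and both sides are zero. *)
Lemma S_path_cat s K t : S_path M (s ++ K :: t) = S_path M (rcons s K) * S_path M (K :: t).
Proof.
rewrite [RHS]ring_quot_piM; congr ring_quot_pi.
have [/[dup] P|nP] := boolP (is_flag_path M (s ++ K :: t)).
  rewrite is_flag_path_cat => /andP[P1 P2]; rewrite (path_eltI P1) (path_eltI P2).
  have e : path_end (FlagPath P1) = path_start (FlagPath P2).
    by rewrite /path_end /path_start /= last_rcons.
  rewrite [_ * _]path_mulUU (path_concatE e) (path_eltI P); congr << _ >>.
  by apply: val_inj; rewrite /= cat_rcons.
rewrite {1}/path_elt insubN //; move: nP; rewrite is_flag_path_cat negb_and.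
by case/orP=> nP; rewrite /path_elt (insubN _ nP);
   rewrite ?[0 * _]path_mul0l ?[_ * 0]path_mul0r.
Qed.

Lemma S_path_cons K L t : S_path M [:: K, L & t] = S_path M [:: K; L] * S_path M (L :: t).
Proof. exact: (S_path_cat [:: K]). Qed.

Lemma S_path_end0 s K L : L != K -> S_path M (rcons s K) * S_path M [:: L] = 0.
Proof.
move=> nLK; rewrite [LHS]ring_quot_piM.
suff -> : path_elt M (rcons s K) * path_elt M [:: L] = 0 by rewrite raddf0.
have [P|nP] := boolP (is_flag_path M (rcons s K)); last first.
  by rewrite /path_elt (insubN _ nP); apply: path_mul0l.
have [Q|nQ] := boolP (is_flag_path M [:: L]); last first.
  by rewrite {2}/path_elt (insubN _ nQ); apply: path_mul0r.
rewrite (path_eltI P) (path_eltI Q) [_ * _]path_mulUU path_concatN //.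
by rewrite /path_end /path_start /= last_rcons eq_sym.
Qed.

Lemma S_path_sum (I : finType) (P : pred I) (f : I -> seq {set E}) :
  \sum_(i | P i) S_path M (f i) = ring_quot_pi _ (\sum_(i | P i) path_elt M (f i)).
Proof. by rewrite raddf_sum. Qed.

Lemma FS_null_down y x : FS_null M (fun c => y * (S_path M c * x)).
Proof.
move=> s L K t fL fK LK e; rewrite -mulr_sumr -mulr_suml.
suff -> : \sum_(X | covered M L X && covered M X K) S_path M (s ++ [:: K, X, L & t]) = 0.
  by rewrite mul0r mulr0.
under eq_bigr do rewrite S_path_cat (S_path_cat [:: K; _]) mulrA.
rewrite -mulr_suml -mulr_sumr S_path_sum ring_quot_pi_rel ?mulr0 ?mul0r //.
exact: FS_down.
Qed.

Lemma FS_null_up y : FS_null M (fun c => y * S_path M (rev c)).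
Proof.
move=> s L K t fL fK LK e; rewrite -mulr_sumr.
suff -> : \sum_(X | covered M L X && covered M X K)
    S_path M (rev (s ++ [:: K, X, L & t])) = 0 by rewrite mulr0.
have er X : rev (s ++ [:: K, X, L & t]) = rev t ++ L :: [:: X] ++ K :: rev s.
  by rewrite rev_cat !rev_cons -!cats1 -!catA.
under eq_bigr do rewrite er S_path_cat (S_path_cat [:: L; _]) mulrA.
rewrite -mulr_suml -mulr_sumr S_path_sum ring_quot_pi_rel ?mulr0 ?mul0r //.
exact: FS_up.
Qed.

Lemma path_degree_cons K L t :
  path_degree [:: K, L & t] = step_degree K L + path_degree (L :: t).
Proof. by rewrite /= big_cons. Qed.

Lemma path_degree_cat s K t : path_degree (s ++ K :: t) =
  path_degree (rcons s K) + path_degree (K :: t).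
Proof.
elim: s => [|L [|L' s] IH]; first by rewrite /= big_nil add0r.
  by rewrite /= !big_cons big_nil addr0.
by rewrite rcons_cons !path_degree_cons -rcons_cons IH addrA.
Qed.

Lemma step_degree_down K L : covered M L K -> step_degree K L = 1.
Proof. by rewrite /step_degree; case/and4P=> _ _ ->. Qed.

Lemma step_degree_up K L : covered M K L -> step_degree K L = -1.
Proof.
rewrite /step_degree => /covered_sub KL; rewrite ifN // properE KL andbF //.
Qed.

Lemma path_degree_flag F K c : flag_to M F K c -> path_degree (K :: c) = (size c)%:Z.
Proof.
elim: c K => [|X c IH] K; first by rewrite /= big_nil.
rewrite flag_to_cons path_degree_cons => /andP[cXK Xc].
by rewrite (step_degree_down cXK) (IH _ Xc).
Qed.

Lemma path_degree_rev s : is_flag_path M s -> path_degree (rev s) = - path_degree s.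
Proof.
elim: s => [|K [|L s] IH] //; first by rewrite /= big_nil oppr0.
rewrite is_flag_path_cons => /and3P[_ aKL P].
rewrite rev_cons rev_cons -cats1 cat_rcons path_degree_cat -rev_cons IH //.
rewrite (path_degree_cons K).
rewrite opprD addrC; congr (_ + _); rewrite /= big_cons big_nil addr0.
by case/orP: aKL => c; rewrite (step_degree_up c) (step_degree_down c) ?opprK.
Qed.

Lemma flag_to_path F K c : flat M K -> flag_to M F K c -> is_flag_path M (K :: c).
Proof.
rewrite /= => -> /andP[/= + _]; apply: sub_path => X Y cYX.
by rewrite /adjacent cYX orbT.
Qed.

Lemma S_path_wedge K L K' : covered M K L -> covered M K' L ->
  S_path M [:: K; L; K'] = ring_quot_pi _ (wedge_value M K L K').
Proof.
move=> cKL cK'L; have := ring_quot_pi_rel (Wedge cKL cK'L).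
rewrite ring_quot_pi_is_zmod_morphism.
by move/eqP; rewrite subr_eq0 => /eqP.
Qed.

(* The wedge relation pushes an initial up step [K < L] through the descending   *)
(* part [L > .. > G] until it is absorbed or reaches the bottom.                 *)
Lemma up_step_span (U : zmodClosed (Defs.S M)) y K L G c t :
  covered M K L -> flag_to M G L c -> path (covered M) G t ->
  (forall G' c' t', flag_to M G' K c' -> path (covered M) G' t' ->
    path_degree (K :: c' ++ t') = path_degree (K :: L :: c ++ t) ->
    y * S_path M (K :: c' ++ t') \in U) ->
  y * S_path M (K :: L :: c ++ t) \in U.
Proof.
elim: c K L y => [|L' c IH] K L y cKL.
  rewrite /flag_to /= => /eqP eLG Gt hU; apply: (hU K [::] (L :: t)) => //=.
  by rewrite cKL eLG.
rewrite flag_to_cons => /andP[cL'L L'c] Gt hU.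
rewrite (S_path_cat [:: K; L] L') S_path_wedge // /wedge_value.
have [eK|nK] := eqVneq K L'.
  rewrite raddfMn mulrnAl mulrnAr rpredMn // -eK -(S_path_cat [::]).
  apply: (hU G c t); rewrite ?eK // !cat_cons !path_degree_cons -eK.
  by rewrite (step_degree_up cKL) (step_degree_down cKL) addrA addNr add0r.
case: ifP => cG; last by rewrite raddf0 mul0r mulr0 rpred0.
set H := K :&: L' in cG *.
have cHL' : covered M H L'.
  have [fH _ _ rH] := coveredP _ _ _ cG; have [fL' _ _ e'] := coveredP _ _ _ cL'L.
  have [_ _ _ e] := coveredP _ _ _ cKL.
  apply/coveredP; split; rewrite ?subsetIr //.
  by rewrite -rH; apply/eqP; rewrite -eqSS -e -e'.
rewrite raddfN mulNr mulrN rpredN -/(S_path M [:: K; H; L']).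
(* The down step from [K] to [H] joins the left factor, while the up step from [H] to [L'] travels
   on through the rest. *)
rewrite -(S_path_cat [:: K; H]) /= S_path_cons mulrA; apply: IH => //.
move=> G' c' t' Hc' Gt' e; rewrite -mulrA -S_path_cons.
apply: (hU G' (H :: c') t') => //; first by rewrite flag_to_cons cG.
rewrite !cat_cons path_degree_cons e !path_degree_cons.
rewrite (step_degree_up cKL) (step_degree_down cL'L) (step_degree_down cG).
by rewrite (step_degree_up cHL') !addrA subrr addNr.
Qed.

(** The left factor [y] is general so that the first step can be set aside while the rest of the
    path is sorted. An initial up step is then pushed down. *)
Lemma down_up_span (U : zmodClosed (Defs.S M)) y K s :
  flat M K -> path (adjacent M) K s ->
  (forall G c t, flag_to M G K c -> path (covered M) G t ->
    path_degree (K :: c ++ t) = path_degree (K :: s) ->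
    y * S_path M (K :: c ++ t) \in U) ->
  y * S_path M (K :: s) \in U.
Proof.
elim: s K y => [|L s IH] K y fK.
  by move=> _ /(_ K [::] [::]); apply; rewrite // /flag_to /=.
case/andP=> aKL Ls hU; rewrite S_path_cons mulrA.
have fL : flat M L by case/orP: aKL => /covered_flat/andP[].
apply: IH => // G c t Lc Gt e; rewrite -mulrA -S_path_cons.
case/orP: aKL => [cKL|cLK]; last first.
  apply: (hU G (L :: c) t) => //; first by rewrite flag_to_cons cLK.
  by rewrite cat_cons path_degree_cons e [RHS]path_degree_cons.
apply: up_step_span cKL Lc Gt _ => G' c' t' Kc' Gt' e'; apply: hU Kc' Gt' _.
by rewrite e' !path_degree_cons e.
Qed.

(** After sorting, (FS) straightens the descending half and, read backwards, the ascending half. The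
    degree is preserved throughout, so the normal form is homogeneous. *)
Lemma standard_flags_span (U : zmodClosed (Defs.S M)) (p : flag_path M) :
  (forall F d u, flat M F -> d \in standard_flags M F -> u \in standard_flags M F ->
    (size d)%:Z - (size u)%:Z = path_degree p ->
    S_path M d * S_path M (rev u) \in U) ->
  S_path M p \in U.
Proof.
have [K [s [-> fK Ks]]] := flag_path_cons p; move=> hU; rewrite -[S_path _ _]mul1r.
apply: down_up_span => // G c t Kc Gt e; rewrite mul1r.
have Kcr : K :: c = rcons (belast K c) G by rewrite lastI; case/andP: Kc => _ /eqP->.
have fG : flat M G.
  case/andP: Kc => pKc /eqP <-; apply: (path_flat fK).
  by apply: sub_path pKc => X Y; rewrite /adjacent orbC => ->.
rewrite -cat_cons Kcr cat_rcons S_path_cat -Kcr.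
have [L [c2 [eL Lc2 sc2]]] : exists L c2, [/\ G :: t = rev (L :: c2),
    flag_to M G L c2 & size c2 = size t].
  exists (last G t), (rev (belast G t)); rewrite rev_cons revK -lastI size_rev size_belast.
  split=> //; rewrite /flag_to rev_path Gt /=.
  by case: (t) => [|X t'] //=; rewrite rev_cons last_rcons.
have fL := flag_to_flat fG Lc2.
rewrite -[_ * _]mul1r.
apply: (nbc_flags_span (h := fun c => 1 * (S_path M c * S_path M (G :: t)))
  (FS_null_down 1 _) Kc erefl) => d dK; rewrite mul1r eL.
apply: (nbc_flags_span (h := fun c => S_path M d * S_path M (rev c))
  (FS_null_up _) Lc2 erefl) => u uL.
apply: (hU G) => //; [exact: mem_standard_flags dK | exact: mem_standard_flags uL |].
have [c' [-> _ sc]] := nbc_flagsP dK; have [c2' [-> _ sc']] := nbc_flagsP uL.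
rewrite -e -cat_cons Kcr cat_rcons path_degree_cat -Kcr (path_degree_flag Kc) eL.
rewrite path_degree_rev; last exact: flag_to_path Lc2.
by rewrite (path_degree_flag Lc2) /= sc sc'; lia.
Qed.

End SpanningS.

(** * Base change of graded free abelian groups *)

Section ZspanBasis.
Variables (A : zmodType) (I : eqType) (l : seq I) (b : I -> A).

Lemma zspan_min (X : A -> Prop) (U : zmodClosed A) :
  (forall x, X x -> x \in U) -> {subset zspan X <= U}.
Proof.
by move=> XU x /asboolP; apply=> //; split=> [|u v]; [apply: rpred0 | apply: rpredB].
Qed.

Lemma zspan_morph (B : zmodType) (f : {additive A -> B}) (X : A -> Prop)
    (U : zmodClosed B) :
  (forall x, X x -> f x \in U) -> {in zspan X, forall x, f x \in U}.
Proof.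
move=> XU x /asboolP/(_ (fun x => f x \in U)); apply=> //.
split=> [|u v hu hv]; rewrite unfold_in ?raddf0 ?rpred0 // raddfB.
exact: rpredB hu hv.
Qed.

Lemma mem_zspan (X : A -> Prop) x : X x -> x \in zspan X.
Proof. by move=> Xx; apply/asboolP => U _; apply. Qed.

Lemma zspan_sum (Q : pred I) a :
  a \in zspan (fun y => exists2 p, p \in l & Q p /\ y = b p) -> uniq l ->
  exists z : I -> int, a = \sum_(p <- l | Q p) b p *~ z p.
Proof.
pose U : {pred A} := fun a =>
  `[< exists z : I -> int, a = \sum_(p <- l | Q p) b p *~ z p >].
move=> /asboolP/(_ U) h ul.
apply/asboolP/h => [|_ [p pl [Qp ->]]].
  split=> [|u v /asboolP[z ->] /asboolP[z' ->]]; apply/asboolP.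
    by exists (fun=> 0); rewrite big1.
  by exists (fun p => z p - z' p); rewrite -sumrB; apply: eq_bigr => p _; rewrite mulrzBr.
apply/asboolP; exists (fun q => (q == p)%:R).
rewrite big_mkcond (bigD1_seq p) //= Qp eqxx big1 ?addr0 // => q /negPf->.
by case: ifP.
Qed.
End ZspanBasis.

Section FreeBaseChange.
Variables (k : fieldType) (A : zmodType) (I : eqType) (l : seq I) (b : I -> A).
Variables (deg : I -> int) (X : int -> A -> Prop).

Lemma tensor1D : {morph @tensor1 k A : a a' / a + a'}.
Proof.
move=> a a'; have lp := lquot_pi_is_linear (@additivity_rel k A).
have : lquot_pi (@additivity_rel k A) (<< a + a' >> - << a >> - << a' >>) = 0.
  by apply: lquot_pi_rel; exists a, a'.
have piN x : lquot_pi (@additivity_rel k A) (- x) = - lquot_pi (@additivity_rel k A) x.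
  rewrite -[- x]addr0 -scaleN1r lp scaleN1r.
  by have := lp (-1) 0 0; rewrite scaler0 addr0 scaleN1r addNr => ->; rewrite addr0.
rewrite !lquot_piD !piN => /eqP; rewrite -addrA -opprD subr_eq0 => /eqP.
exact.
Qed.

Lemma tensor1_is_zmod_morphism : zmod_morphism (@tensor1 k A).
Proof. by move=> a a'; apply/eqP; rewrite eq_sym subr_eq -tensor1D subrK. Qed.
HB.instance Definition _ := GRing.isZmodMorphism.Build A (base_change k A)
  (@tensor1 k A) tensor1_is_zmod_morphism.

Lemma tensor1Mz (a : A) (n : int) : tensor1 k (a *~ n) = n%:~R *: tensor1 k a.
Proof. by rewrite raddfMz scaler_int. Qed.

Lemma base_change_gen (U : submodClosed (base_change k A)) v :
  (forall a, tensor1 k a \in U) -> v \in U.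
Proof.
move=> tU; have [w ->] := lquot_piP v; have lp := lquot_pi_is_linear (@additivity_rel k A).
rewrite (monalgE w); elim: (enum_fset _) => [|a r IH].
  rewrite big_nil; have := lp (-1) 0 0.
  by rewrite scaler0 addr0 scaleN1r addNr => ->; apply: rpred0.
rewrite big_cons; have -> : << w@_a *g a >> = w@_a *: << a >> :> {malg k[A]}.
  by apply/malgP => q; rewrite mcoeffZ !mcoeffU -mulr_natr; case: (a == q);
     rewrite ?mulr1 ?mulr0.
by rewrite lp rpredD // rpredZ // tU.
Qed.

Hypothesis uniq_l : uniq l.
Hypothesis free_b : forall z : I -> int, \sum_(p <- l) b p *~ z p = 0 ->
  {in l, forall p, z p = 0}.
Hypothesis span_b : forall a, a \in zspan (fun y => exists2 p, p \in l & y = b p).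
Hypothesis homog_b : {in l, forall p, X (deg p) (b p)}.
Hypothesis span_homog : forall i a, X i a ->
  a \in zspan (fun y => exists2 p, p \in l & deg p = i /\ y = b p).

Definition basis_change (p : I) : base_change k A := tensor1 k (b p).

(** Freeness makes the integer coordinates unique, hence additive in the element of [A]. The
    universal property of the base change turns them into linear functionals over [k]. *)
Lemma coordinates_exist (p : I) : exists g : base_change k A -> k^o,
  linear g /\ {in l, forall q, g (basis_change q) = (q == p)%:R}.
Proof.
have /choice[c cE] a : exists z : I -> int, a = \sum_(p <- l) b p *~ z p.
  apply: zspan_sum => //; apply: zspan_min (span_b a) => _ [q ql ->].
  by apply: mem_zspan; exists q.
have cU a z : a = \sum_(p <- l) b p *~ z p -> {in l, c a =1 z}.
  move=> e q ql; apply/eqP; rewrite -subr_eq0; apply/eqP.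
  apply: (free_b (z := fun q => c a q - z q)) ql.
  under eq_bigr do rewrite mulrzBr; rewrite sumrB -cE -e subrr //.
have [pl|npl] := boolP (p \in l); last first.
  exists (fun=> 0); split=> [a u v|q ql]; first by rewrite scaler0 addr0.
  by case: eqP npl => // <-; rewrite ql.
have [|g [[lg gE] _]] := @base_change_universal k A k^o (fun a => (c a p)%:~R).
  move=> a a'; rewrite (cU _ (fun q => c a q + c a' q)) ?rmorphD //.
  by under eq_bigr do rewrite mulrzDr; rewrite big_split /= -!cE.
exists g; split=> // q ql; rewrite gE (cU _ (fun q' => (q' == q)%:R)) //.
  by rewrite eq_sym; case: eqP.
rewrite (bigD1_seq q) //= eqxx big1 ?addr0 // => q' /negPf->.
by rewrite mulr0z.
Qed.

Definition coordinate p : base_change k A -> k^o := sval (cid (coordinates_exist p)).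

Lemma coordinate_is_linear p : linear (coordinate p).
Proof. by rewrite /coordinate; case: cid => g []. Qed.
HB.instance Definition _ p := GRing.isLinear.Build k (base_change k A) k^o _
  (coordinate p) (coordinate_is_linear p).

Lemma coordinate_basis p q : q \in l -> coordinate p (basis_change q) = (q == p)%:R.
Proof. by rewrite /coordinate; case: cid => g /= [_]; apply. Qed.

(** The projection onto the span of the basis elements satisfying [Q]. Taken at a fixed degree, its
    image is the graded part of that degree. *)
Definition homog_part (Q : pred I) v : base_change k A :=
  \sum_(p <- l | Q p) (coordinate p v : k) *: basis_change p.

Lemma coordinate_homog_part Q p v : p \in l ->
  coordinate p (homog_part Q v) = if Q p then coordinate p v else 0.
Proof.
move=> pl; rewrite linear_sum /= big_mkcond (bigD1_seq p) //= big1_seq ?addr0.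
  rewrite linearZ /= coordinate_basis // eqxx; case: ifP => // _.
  by rewrite /GRing.scale /= mulr1.
move=> q /andP[nqp ql]; rewrite linearZ /= coordinate_basis // (negPf nqp).
by rewrite scaler0 if_same.
Qed.

Lemma homog_part_is_linear Q : linear (homog_part Q).
Proof.
move=> a u v; rewrite /homog_part scaler_sumr -big_split /=; apply: eq_bigr => p _.
by rewrite linearP scalerDl scalerA.
Qed.

Lemma homog_part_basis (Q : pred I) p : p \in l -> Q p ->
  homog_part Q (basis_change p) = basis_change p.
Proof.
move=> pl Qp; rewrite /homog_part big_mkcond (bigD1_seq p) //= Qp.
rewrite coordinate_basis // eqxx scale1r big1_seq ?addr0 // => q /andP[nqp ql].
by rewrite coordinate_basis // eq_sym (negPf nqp) scale0r if_same.
Qed.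

Lemma homog_part_sum (Q : pred I) (z : I -> int) :
  let a := \sum_(p <- l | Q p) b p *~ z p in
  homog_part Q (tensor1 k a) = tensor1 k a.
Proof.
pose hp : {linear _ -> _} := HB.pack (homog_part Q)
  (GRing.isLinear.Build k (base_change k A) (base_change k A) _ (homog_part Q)
     (homog_part_is_linear Q)).
rewrite /=.
have -> : tensor1 k (\sum_(p <- l | Q p) b p *~ z p) =
    \sum_(p <- l | Q p) (z p)%:~R *: basis_change p.
  by rewrite raddf_sum; apply: eq_bigr => p _; apply: tensor1Mz.
rewrite -[homog_part Q]/(hp : _ -> _) linear_sum big_seq_cond [RHS]big_seq_cond.
apply: eq_bigr => p /andP[pl Qp]; rewrite linearZ /=.
by rewrite homog_part_basis.
Qed.

Lemma homog_part_fix_closed Q : submod_closed (fun v => homog_part Q v == v).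
Proof.
split=> [|a u v]; rewrite !unfold_in.
  have := homog_part_is_linear Q (-1) 0 0; rewrite scaler0 addr0 scaleN1r addNr.
  by move->.
by move=> /eqP eu /eqP ev; rewrite homog_part_is_linear eu ev.
Qed.

Definition graded_part (i : int) : {pred base_change k A} :=
  lspan (fun z => exists2 x, X i x & z = tensor1 k x).

Lemma graded_partE i v : v \in graded_part i -> v = homog_part (fun p => deg p == i) v.
Proof.
move=> /asboolP h; apply/esym/eqP; apply: (h (fun v => homog_part _ v == v)).
  exact: homog_part_fix_closed.
move=> _ [x Xx ->]; rewrite unfold_in.
have [|z ->] := zspan_sum (a := x) (b := b) (Q := fun p => deg p == i) _ uniq_l; last first.
  by rewrite homog_part_sum.
apply: zspan_min (span_homog Xx) => y [p pl [dp ->]]; apply: mem_zspan.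
by exists p => //; rewrite dp eqxx.
Qed.

Lemma mem_graded_part i v : homog_part (fun p => deg p == i) v \in graded_part i.
Proof.
rewrite /homog_part big_seq_cond; apply: rpred_sum => p /andP[pl /eqP <-].
apply: rpredZ; apply/asboolP => U _; apply; exists (b p) => //; exact: homog_b.
Qed.

Lemma base_change_expand v : v = homog_part predT v.
Proof.
pose U := HB.pack_for (submodClosed (base_change k A)) (fun v => homog_part predT v == v)
  (GRing.isSubmodClosed.Build _ _ _ (homog_part_fix_closed predT)).
apply/esym/eqP; apply: (@base_change_gen U v) => a; rewrite unfold_in.
have [|z ->] := zspan_sum (a := a) (b := b) (Q := predT) _ uniq_l; last first.
  by rewrite homog_part_sum.
by apply: zspan_min (span_b a) => _ [q ql ->]; apply: mem_zspan; exists q.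
Qed.

Lemma sum_by_degree (V : nmodType) (f : I -> V) :
  \sum_(i <- undup (map deg l)) \sum_(p <- l | deg p == i) f p = \sum_(p <- l) f p.
Proof.
rewrite (exchange_big_dep predT) //= [LHS]big_seq [RHS]big_seq.
apply: eq_bigr => p pl; rewrite -big_filter (eq_filter (a2 := pred1 (deg p))).
  by rewrite filter_pred1_uniq ?undup_uniq ?mem_undup ?map_f // big_seq1.
by move=> i /=; rewrite eq_sym.
Qed.

(** The basis elements of degree $i$ form a basis of the part of degree $i$, so the graded dimension
    is the sum of $t^{\deg}$ over the whole basis. *)
Lemma free_graded_dim : has_graded_dim graded_part (\sum_(p <- l) tvar ^ deg p).
Proof.
split; first split=> [i|v|s f us fX sf0 i si].
- exact: lspan_submod_closed.
- exists (undup (map deg l)), (fun i => homog_part (fun p => deg p == i) v).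
  split=> [i|]; first exact: mem_graded_part.
  by rewrite {1}(base_change_expand v) /homog_part sum_by_degree.
- have h := fX i; apply/eqP; rewrite (graded_partE (fX i)); apply/eqP.
  rewrite /homog_part big_seq_cond big1 // => p /andP[pl /eqP dp].
  suff -> : coordinate p (f i) = 0 by rewrite scale0r.
  have := congr1 (coordinate p) sf0; rewrite linear_sum linear0 (bigD1_seq i) //=.
  rewrite big1 ?addr0 // => j nji; rewrite (graded_partE (fX j)).
  by rewrite coordinate_homog_part // dp eq_sym (negPf nji).
pose li i := [seq p <- l | deg p == i].
exists (fun i => size (li i)), (undup (map deg l)); split.
- exact: undup_uniq.
- move=> i; pose b' j := basis_change (tnth (in_tuple (li i)) j).
  have li_in j : tnth (in_tuple (li i)) j \in l /\ deg (tnth (in_tuple (li i)) j) = i.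
    by have := mem_tnth j (in_tuple (li i)); rewrite mem_filter => /andP[/eqP].
  exists b'; split=> [j|v vi].
    have [jl dj] := li_in j; rewrite -dj; apply/asboolP => U _; apply.
    by exists (b (tnth (in_tuple (li i)) j)) => //; apply: homog_b.
  exists (\row_j coordinate (tnth (in_tuple (li i)) j) v); split.
    rewrite {1}(graded_partE vi) /homog_part -big_filter -/(li i) big_tnth.
    by apply: eq_bigr => j _; rewrite mxE.
  move=> c ec; apply/rowP => j; rewrite mxE ec linear_sum (bigD1 j) //= big1 ?addr0.
    by rewrite linearZ /= coordinate_basis ?eqxx /GRing.scale /= ?mulr1 //; case: (li_in j).
  move=> j' nj; rewrite linearZ /= coordinate_basis; last by case: (li_in j').
  have /tuple_uniqP inj : uniq (in_tuple (li i)) by apply: filter_uniq.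
  by rewrite (inj_eq inj) (negPf nj) scaler0.
- move=> i; rewrite mem_undup => ni; apply/eqP; rewrite size_eq0 -[_ == _]negbK -has_filter.
  by apply/hasPn => p pl; apply: contra ni => /eqP <-; apply: map_f.
rewrite -sum_by_degree; apply: eq_bigr => i _.
rewrite (eq_bigr (fun=> tvar ^ i)) => [|p /eqP-> //].
by rewrite big_const_seq iter_addr_0 /li size_filter mulr_natl.
Qed.

Lemma graded_part_lt0 : {in l, forall p, 0 <= deg p} ->
  forall i v, i < 0 -> v \in graded_part i -> v = 0.
Proof.
move=> dl i v i0 /graded_partE ->; rewrite /homog_part big_seq_cond big1 //.
move=> p /andP[pl /eqP dp]; have := dl p pl; rewrite dp leNgt i0 //.
Qed.
End FreeBaseChange.

(** * Bases of S(M) and of the standard modules *)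

Section BasisOfS.
Variables (E : finType) (M : matroid E).
Implicit Types (F G H K L X Y S T U : {set E}) (s t c d u : seq {set E}).
Notation rk := (rank M).

Lemma S_path_total (x : Defs.S M) :
  x \in zspan (fun y => exists p : flag_path M, y = S_path M p).
Proof.
have [a ->] := ring_quot_piP x; rewrite (monalgE a).
elim: (enum_fset _) => [|p r IH]; first by rewrite big_nil raddf0 rpred0.
rewrite big_cons raddfD rpredD //=.
have -> : << a@_p *g p >> = << p >> *~ a@_p :> path_alg M.
  apply/malgP => q; rewrite (raddfMz (mcoeff q)) /= !mcoeffU.
  by case: (p == q); rewrite ?mulr1n ?mulr0n ?mul0rz // intz.
rewrite raddfMz rpredMz //; apply: mem_zspan; exists p.
by rewrite /S_path path_eltE.
Qed.

Lemma standard_flags_path F d : flat M F -> d \in standard_flags M F ->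
  is_flag_path M d.
Proof. by move=> fF /standard_flagsP[K [c [-> Kc fK]]]; apply: flag_to_path Kc. Qed.

Lemma rev_flag_path d : is_flag_path M d -> is_flag_path M (rev d).
Proof.
elim: d => [|K [|L s] IH] //; rewrite is_flag_path_cons => /and3P[fK aKL P].
rewrite !rev_cons -cats1 cat_rcons is_flag_path_cat -rev_cons IH //=.
rewrite /adjacent orbC -/(adjacent M K L) aKL.
by case/orP: aKL => /covered_flat/andP[fX fY]; rewrite ?fX ?fY.
Qed.

Definition S_index : seq ({set E} * (seq {set E} * seq {set E})) :=
  [seq (F, du) | F <- [seq F <- index_enum {set E} | flat M F],
                 du <- [seq (d, u) | d <- standard_flags M F, u <- standard_flags M F]].

Definition S_basis (i : {set E} * (seq {set E} * seq {set E})) : Defs.S M :=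
  S_path M i.2.1 * S_path M (rev i.2.2).

Definition S_basis_degree (i : {set E} * (seq {set E} * seq {set E})) : int :=
  (size i.2.1)%:Z - (size i.2.2)%:Z.

Lemma mem_S_index F d u : ((F, (d, u)) \in S_index) =
  [&& flat M F, d \in standard_flags M F & u \in standard_flags M F].
Proof.
apply/allpairsPdep/and3P => [[F' [_ [+ /allpairsP[[d' u'] [dF uF ->]] []]]]|[fF dF uF]].
  by rewrite mem_filter => /andP[fF _] -> -> ->.
exists F, (d, u); split=> //; first by rewrite mem_filter fF mem_index_enum.
by apply/allpairsP; exists (d, u).
Qed.

Lemma uniq_S_index : uniq S_index.
Proof.
apply: allpairs_uniq_dep; first exact: filter_uniq (index_enum_uniq _).
  move=> F _; apply: allpairs_uniq; try exact: uniq_standard_flags.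
  by move=> [d u] [d' u'] _ _.
by move=> [F x] [G y] _ _ /= [-> ->].
Qed.

(** The two flags meet at [F], so the product is the class of one flag path through [F]. Its degree
    and end can be read off, and it acts by zero wherever [F] is cut out. *)
Lemma S_basis_path F d u : flat M F -> d \in standard_flags M F ->
  u \in standard_flags M F -> exists p : flag_path M,
  [/\ S_basis (F, (d, u)) = S_path M p, path_degree p = S_basis_degree (F, (d, u)),
      F \in (p : seq _) & path_end p = head F u].
Proof.
move=> fF dF uF; have P := standard_flags_path fF dF; have Q := standard_flags_path fF uF.
have [K [c [ed Kc fK]]] := standard_flagsP dF.
have [L [c2 [eu Lc fL]]] := standard_flagsP uF.
have ed' : d = rcons (belast K c) F by rewrite ed lastI; case/andP: Kc => _ /eqP->.
have eu' : rev u = F :: rev (belast L c2).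
  by rewrite eu lastI rev_rcons; case/andP: Lc => _ /eqP->.
have R : is_flag_path M (belast K c ++ rev u).
  by rewrite eu' is_flag_path_cat -ed' P -eu' rev_flag_path.
exists (FlagPath R) => /=; split.
- by rewrite /S_basis eu' S_path_cat -ed'.
- rewrite eu' path_degree_cat -ed' -eu' (path_degree_rev Q) ed eu.
  by rewrite (path_degree_flag Kc) (path_degree_flag Lc) /S_basis_degree /=; lia.
- by rewrite eu' mem_cat inE eqxx orbT.
by rewrite /path_end eu rev_cons last_cat last_rcons.
Qed.

Lemma S_basis_span (p : flag_path M) :
  S_path M p \in zspan (fun y => exists2 i, i \in S_index &
    S_basis_degree i = path_degree p /\ y = S_basis i).
Proof.
apply: standard_flags_span => F d u fF dF uF e; apply: mem_zspan.
by exists (F, (d, u)); rewrite // mem_S_index fF dF.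
Qed.

(* If [F] is maximal in the support of a relation, only the terms [d * u]        *)
(* through [F] survive on the exterior algebra of [M_F], where [d] followed by   *)
(* [u] factors through the line spanned by the empty monomial.                   *)
Lemma S_basis_free (z : _ -> int) : \sum_(i <- S_index) S_basis i *~ z i = 0 ->
  {in S_index, forall i, z i = 0}.
Proof.
move=> z0 [F [d u]]; rewrite mem_S_index => /and3P[fF dF uF].
(* Induction on the complement treats larger flats first, so terms through flats strictly above [F]
   are already gone. *)
elim: {F}_.+1 {-2}F (ltnSn #|~: F|) d u fF dF uF => // n IH F cF d u fF dF uF.
have zG G i : i \in S_index -> i.1 = G -> F \proper G -> z i = 0.
  case: i => _ [d' u'] /[swap] /= -> + FG; rewrite mem_S_index => /and3P[fG dG uG].
  apply: IH fG dG uG; rewrite -ltnS (leq_trans _ cF) // ltnS.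
  by rewrite proper_card // properC.
have key S T : \sum_(d <- standard_flags M F)
    (\sum_(u <- standard_flags M F) z (F, (d, u)) * act M F u T set0) *
      act M F d S set0 = 0.
  have := congr1 (S_act F S T) z0; rewrite raddf_sum raddf0 big_allpairs_dep.
  rewrite big_filter (bigD1 F) //= [X in _ + X]big1 ?addr0 => [|G /andP[fG nGF]]; last first.
    rewrite big_seq big1 // => -[d' u'] /allpairsP[[d1 u1] [dG uG [-> ->]]].
    have iG : (G, (d1, u1)) \in S_index by rewrite mem_S_index fG dG.
    rewrite raddfMz /=; have [FG|nFG] := boolP (F \subset G).
      by rewrite (zG G) // properEneq eq_sym nGF.
    have [p [-> _ Gp _]] := S_basis_path fG dG uG.
    by rewrite S_act_path ?(valP p) // (act_eq0 _ _ _ Gp nFG) mul0rz.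
  move=> e; rewrite -[RHS]e big_allpairs [LHS]big_seq [RHS]big_seq.
  apply: eq_bigr => d1 d1F; rewrite mulr_suml [LHS]big_seq [RHS]big_seq.
  apply: eq_bigr => u1 u1F; rewrite raddfMz /= S_actM.
  have P := standard_flags_path fF d1F; have Q := standard_flags_path fF u1F.
  (* Both flags meet at [F], whose only basis relative to itself is empty. The matrix product thus
     reduces to a single term and has rank one. *)
  rewrite (bigD1 set0) //= big1 ?addr0 => [|U nU]; last first.
    rewrite S_act_path //; have [K [c [ed Kc fK]]] := standard_flagsP d1F.
    have -> : d1 = rcons (belast K c) F by rewrite ed lastI; case/andP: Kc => _ /eqP->.
    by rewrite act_end ?mul0r // rel_basisFF.
  rewrite !S_act_path ?rev_flag_path // act_rev -mulrzr intz.
  by ring.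
(* For each fixed [T], independence in [d] leaves a relation among the [u], to which independence
   applies once more. *)
apply: (standard_flags_free (z := fun u => z (F, (d, u))) fF) uF => T.
by apply: (standard_flags_free (z := fun d => \sum_(u <- standard_flags M F)
  z (F, (d, u)) * act M F u T set0) fF) dF => S; apply: key.
Qed.

Lemma S_graded_dim (k : fieldType) :
  has_graded_dim (Sk_grade k M) (\sum_(i <- S_index) tvar ^ S_basis_degree i).
Proof.
apply: (@free_graded_dim k _ _ S_index S_basis S_basis_degree
  (fun i x => x \in S_grade M i)).
- exact: uniq_S_index.
- exact: S_basis_free.
- move=> a; apply: zspan_min (S_path_total a) => _ [p ->].
  by apply: zspan_min (S_basis_span p) => _ [i il [_ ->]]; apply: mem_zspan; exists i.
- move=> [F [d u]]; rewrite mem_S_index => /and3P[fF dF uF].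
  by have [p [-> <- _ _]] := S_basis_path fF dF uF; apply: mem_zspan; exists p.
move=> i a; apply: zspan_min => _ [p [<- ->]]; exact: S_basis_span.
Qed.

End BasisOfS.

Section ZQuotient.
Variables (V : zmodType) (X : V -> Prop).

Lemma zquot_pi_is_zmod_morphism : zmod_morphism (@zquot_pi V X).
Proof. by move=> u v; rewrite /zquot_pi Quotient.pi_add Quotient.pi_opp. Qed.
HB.instance Definition _ := GRing.isZmodMorphism.Build V (zquot X)
  (@zquot_pi V X) zquot_pi_is_zmod_morphism.

Lemma zquot_pi_eq0 v : zquot_pi X v = 0 <-> v \in zspan X.
Proof.
rewrite -(raddf0 (@zquot_pi V X)); split=> [/eqP|vX].
  by rewrite -Quotient.idealrBE subr0.
by apply/eqP; rewrite -Quotient.idealrBE subr0.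
Qed.

Lemma zquot_piP (x : zquot X) : exists v, x = zquot_pi X v.
Proof. by exists (repr (x : Quotient.quot (zspan X))); rewrite /zquot_pi reprK. Qed.
End ZQuotient.

(** * Basis of the standard module *)

Section BasisOfStandard.
Variables (E : finType) (M : matroid E) (F : {set E}).
Hypothesis fF : flat M F.
Implicit Types (G H K L X Y S T U : {set E}) (s t c d u : seq {set E}).
Notation rk := (rank M).
Notation e := (S_path M [:: F]).

Lemma mulr_left_ideal (x : Defs.S M) : x * e \in principal_left e.
Proof. by apply/asboolP; exists x. Qed.

Definition to_left_ideal (x : Defs.S M) : left_ideal e := Sub (x * e) (mulr_left_ideal x).

(** Defined on all of [S M] through right multiplication by the idempotent of [F], so that spanning
    results for [S M] carry over along an additive map. *)
Definition to_standard (x : Defs.S M) : standard M F :=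
  zquot_pi (@standard_sub E M F) (to_left_ideal x).

Lemma to_standard_is_zmod_morphism : zmod_morphism to_standard.
Proof.
move=> x y; rewrite /to_standard -raddfB; congr zquot_pi; apply: val_inj.
by rewrite raddfB /= mulrBl.
Qed.
HB.instance Definition _ := GRing.isZmodMorphism.Build (Defs.S M) (standard M F)
  to_standard to_standard_is_zmod_morphism.

Lemma S_path_mul_end (p : flag_path M) :
  S_path M p * e = if path_end p == F then S_path M p else 0.
Proof.
have [K [s [ep fK Ks]]] := flag_path_cons p.
have -> : (p : seq _) = rcons (belast K s) (path_end p) by rewrite /path_end ep -lastI.
rewrite {2}/path_end last_rcons; case: eqP => [->|/eqP ne].
  by rewrite -S_path_cat cats1.
by rewrite S_path_end0 // eq_sym.
Qed.

Lemma mul_end_idem : e * e = e.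
Proof.
have P : is_flag_path M [:: F] by rewrite /= fF.
by have := S_path_mul_end (FlagPath P); rewrite /path_end /= eqxx.
Qed.

Lemma val_left_ideal (x : left_ideal e) : val x * e = val x.
Proof. by have /asboolP[a ->] := valP x; rewrite -mulrA mul_end_idem. Qed.

Lemma to_standard_val (x : left_ideal e) :
  to_standard (val x) = zquot_pi (@standard_sub E M F) x.
Proof. by congr zquot_pi; apply: val_inj; rewrite /= val_left_ideal. Qed.

(** A basis product through [G] dies if it does not end at [F], and also if [G] does not contain
    [F]. Otherwise [G] lies below the end [F] and contains it, so [G = F] and the ascending part is
    trivial. *)
Lemma to_standard_span (p : flag_path M) : to_standard (S_path M p) \in
  zspan (fun y => exists2 d, d \in standard_flags M F &
    (size d)%:Z - 1 = path_degree p /\ y = to_standard (S_path M d)).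
Proof.
apply: (zspan_morph (f := to_standard) _ (S_basis_span p)) => x [[G [d u]]].
rewrite mem_S_index => /and3P[fG dG uG] [ep ->] /=.
have [q [eq dq Gq endq]] := S_basis_path fG dG uG.
have [L [c2 [eu Lc fL]]] := standard_flagsP uG.
rewrite eu /= in endq; have [eL|nL] := eqVneq L F; last first.
  rewrite eq /to_standard (_ : to_left_ideal _ = 0) ?raddf0 ?rpred0 //.
  by apply: val_inj; rewrite /= S_path_mul_end endq (negPf nL).
have [FG|nFG] := boolP (F \subset G); last first.
  rewrite eq (_ : to_standard _ = 0) ?rpred0 //.
  apply/zquot_pi_eq0; apply: mem_zspan; exists q; split.
  - by rewrite endq.
  - by exists G.
  by rewrite /= S_path_mul_end endq eL eqxx.
have eGF : G = F.
  by apply/eqP; rewrite eqEsubset FG andbT -eL; apply: flag_to_sub Lc.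
have c20 : c2 = [::].
  apply: size0nil; have := flag_to_rank Lc; rewrite eL eGF.
  by move/eqP; rewrite -{1}[rk F]add0n eqn_add2r => /eqP.
rewrite /S_basis /= eu c20 eL /= [rev _]/(nseq 1 F).
apply: mem_zspan; exists d; first by rewrite -eGF.
rewrite -ep /S_basis_degree /= eu c20; split=> //.
rewrite /to_standard; congr zquot_pi; apply: val_inj => /=.
by rewrite -mulrA mul_end_idem.
Qed.

(** The paths divided out pass through a flat not containing [F], hence act by zero on the exterior
    algebra of $M_F$. The functionals proving independence of the flags thus vanish on everything
    divided out. *)
Lemma standard_sub_act (x : left_ideal e) S :
  x \in zspan (@standard_sub E M F) -> S_act F S set0 (val x) = 0.
Proof.
pose U : {pred left_ideal e} := fun x => S_act F S set0 (val x) == 0.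
move=> /asboolP/(_ U) h; apply/eqP; apply: h.
  split=> [|y z /(eqP (y := 0)) hy /(eqP (y := 0)) hz].
    by rewrite unfold_in /U GRing.val0 raddf0.
  by rewrite unfold_in /U GRing.valB raddfB /= hy hz subrr.
move=> y [p [_ [K Kp nFK] ey]]; rewrite unfold_in /U ey S_act_path ?(valP p) //.
by rewrite (act_eq0 _ _ _ Kp).
Qed.

Lemma standard_basis_free (z : seq {set E} -> int) :
  \sum_(d <- standard_flags M F) to_standard (S_path M d) *~ z d = 0 ->
  {in standard_flags M F, forall d, z d = 0}.
Proof.
move=> z0; apply: standard_flags_free => // S.
have : to_standard (\sum_(d <- standard_flags M F) S_path M d *~ z d) = 0.
  by rewrite raddf_sum -[RHS]z0; apply: eq_bigr => d _; rewrite raddfMz.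
move/zquot_pi_eq0/(standard_sub_act S) => /= h; rewrite -[RHS]h mulr_suml raddf_sum.
rewrite [LHS]big_seq [RHS]big_seq; apply: eq_bigr => d dF.
have P := standard_flags_path fF dF.
have [K [c [ed Kc fK]]] := standard_flagsP dF.
have -> : S_path M d *~ z d * e = S_path M d *~ z d.
  rewrite mulrzAl (S_path_mul_end (FlagPath P)) /path_end /= ed /=.
  by case/andP: Kc => _ /eqP->; rewrite eqxx.
by rewrite raddfMz /= S_act_path // -mulrzr intz mulrC.
Qed.

Lemma to_standard_path_grade d : d \in standard_flags M F ->
  standard_grade M F ((size d)%:Z - 1) (to_standard (S_path M d)).
Proof.
move=> dF; have P := standard_flags_path fF dF.
have [K [c [ed Kc fK]]] := standard_flagsP dF.
exists (to_left_ideal (S_path M d)) => //=.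
have -> : S_path M d * e = S_path M d.
  rewrite (S_path_mul_end (FlagPath P)) /path_end /= ed /=.
  by case/andP: Kc => _ /eqP->; rewrite eqxx.
apply: mem_zspan; exists (FlagPath P); split=> //=.
by rewrite ed (path_degree_flag Kc) /=; lia.
Qed.

Lemma standard_basis_span i (y : standard M F) : standard_grade M F i y ->
  y \in zspan (fun y => exists2 d, d \in standard_flags M F &
    (size d)%:Z - 1 = i /\ y = to_standard (S_path M d)).
Proof.
case=> x xi ->; rewrite -to_standard_val.
apply: (zspan_morph (f := to_standard) _ xi) => _ [p [<- ->]]; exact: to_standard_span.
Qed.

Lemma standard_total_span (y : standard M F) :
  y \in zspan (fun y => exists2 d, d \in standard_flags M F & y = to_standard (S_path M d)).
Proof.
have [x ->] := zquot_piP y; rewrite -to_standard_val.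
apply: (zspan_morph (f := to_standard) _ (S_path_total (val x))) => _ [p ->].
apply: zspan_min (to_standard_span p) => _ [d dF [_ ->]].
by apply: mem_zspan; exists d.
Qed.

Lemma standard_graded_dim (k : fieldType) :
  has_graded_dim (standardk_grade k M F)
    (\sum_(d <- standard_flags M F) tvar ^ ((size d)%:Z - 1)).
Proof.
apply: (@free_graded_dim k _ _ (standard_flags M F) (fun d => to_standard (S_path M d))
  (fun d => (size d)%:Z - 1) (fun i y => standard_grade M F i y)).
- exact: uniq_standard_flags.
- exact: standard_basis_free.
- exact: standard_total_span.
- exact: to_standard_path_grade.
exact: standard_basis_span.
Qed.

Lemma standardk_grade_lt0 (k : fieldType) i (v : standardk k M F) : i < 0 ->
  v \in standardk_grade k M F i -> v = 0.
Proof.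
apply: (@graded_part_lt0 k _ _ (standard_flags M F) (fun d => to_standard (S_path M d))
  (fun d => (size d)%:Z - 1) (fun i y => standard_grade M F i y)).
- exact: uniq_standard_flags.
- exact: standard_basis_free.
- exact: standard_total_span.
- exact: standard_basis_span.
by move=> d /standard_flagsP[K [c [-> _ _]]] /=; lia.
Qed.

End BasisOfStandard.

(** * Graded dimensions *)

Section FieldMonomials.
Variables (K : fieldType) (x : K).
Hypothesis x_neq0 : x != 0.

(** Used with [a] the rank of [G] over [F] and [b] the corank of [G], so that [a + b] is the rank of
    $M_F$ for every [G]. *)
Lemma signed_monomial_inversion (z : int) a b :
  ((-1) ^+ a * z)%:~R * x ^+ a = (- x) ^+ (a + b) * (z%:~R * (- x^-1) ^+ b).
Proof.
rewrite rmorphM rmorphXn rmorphN1 /= exprD -invrN exprVn mulrCA.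
rewrite mulfK ?expf_neq0 ?oppr_eq0 //.
by rewrite (exprNn x) mulrCA mulrA.
Qed.

Lemma opposite_powers_cancel n (p q : K) :
  (- x) ^+ n * p * ((- x^-1) ^+ n * q) = q * p.
Proof. by rewrite mulrACA -exprMn mulrNN divff // expr1n mul1r mulrC. Qed.

Lemma exprz_sub (m n : int) : x ^ (m - n) = x ^ (m - 1) * x^-1 ^ (n - 1).
Proof. by rewrite exprz_inv -expfzDr //; congr (_ ^ _); ring. Qed.
End FieldMonomials.

Section GradedDimensionFormulas.
Variables (E : finType) (M : matroid E).
Implicit Types (F G H K : {set E}) (x : ratfun).
Notation rk := (rank M).

Lemma tvar_neq0 : tvar != 0.
Proof. by rewrite /tvar tofrac_eq0 polyX_eq0. Qed.

Lemma eval_contraction_charpoly F x : eval_ratfun (contraction_charpoly M F) x =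
  \sum_(G | flat M G && (F \subset G)) (mobius M F G)%:~R * x ^+ (rk setT - rk G).
Proof.
rewrite /eval_ratfun -/(map_poly intr _) rmorph_sum horner_sum.
by apply: eq_bigr => G _; rewrite /= map_polyZ /= map_polyXn hornerZ hornerXn.
Qed.

(** Stated for any nonzero [x] because $S_k(M)$ needs it at both $t$ and $t^{-1}$. *)
Lemma sum_mobius_plus F x : x != 0 ->
  \sum_(G | flat M G && (F \subset G)) (mobius_plus M F G)%:~R * x ^+ (rk G - rk F) =
  (- x) ^+ contraction_rank M F * eval_ratfun (contraction_charpoly M F) (- x^-1).
Proof.
move=> x0; rewrite eval_contraction_charpoly mulr_sumr; apply: eq_bigr => G /andP[_ FG].
rewrite /contraction_rank -(subnK (rank_mono M (subsetT G))) -addnBA ?rank_mono //.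
by rewrite addnC addnK; apply: signed_monomial_inversion.
Qed.

Lemma sum_standard_flags F x : flat M F ->
  \sum_(d <- standard_flags M F) x ^ ((size d)%:Z - 1) =
  \sum_(G | flat M G && (F \subset G)) (mobius_plus M F G)%:~R * x ^+ (rk G - rk F).
Proof.
move=> fF; rewrite big_allpairs_dep big_filter; apply: eq_bigr => G /andP[fG FG].
rewrite (eq_big_seq (fun=> x ^+ (rk G - rk F))) => [|d /nbc_flagsP[c [-> _ <-]]].
  rewrite big_const_seq count_predT iter_addr_0 -mulr_natl; congr (_ * _).
  rewrite pmulrn; congr (_ %:~R); rewrite size_nbc_flags //.
  by rewrite subnK // rank_mono.
by rewrite /= -addn1 PoszD addrK.
Qed.

(** The degree of a basis element is a difference of lengths, so the sum over pairs factors into the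
    standard sums at $t$ and $t^{-1}$. The prefactors $(-t)^r$ and $(-t^{-1})^r$ cancel. *)
Lemma sum_S_index : \sum_(i <- S_index M) tvar ^ S_basis_degree i =
  \sum_(F | flat M F) eval_ratfun (contraction_charpoly M F) (- tvar) *
    eval_ratfun (contraction_charpoly M F) (- tvar^-1).
Proof.
have t0 := tvar_neq0; have tV0 : tvar^-1 != 0 by rewrite invr_eq0.
rewrite big_allpairs_dep big_filter; apply: eq_bigr => F fF; rewrite big_allpairs.
transitivity ((\sum_(d <- standard_flags M F) tvar ^ ((size d)%:Z - 1)) *
  (\sum_(u <- standard_flags M F) (tvar^-1) ^ ((size u)%:Z - 1))).
  rewrite mulr_suml; apply: eq_bigr => d _; rewrite mulr_sumr; apply: eq_bigr => u _.
  by rewrite /S_basis_degree /= (exprz_sub t0).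
rewrite !sum_standard_flags // !sum_mobius_plus // invrK.
by rewrite (opposite_powers_cancel t0).
Qed.

End GradedDimensionFormulas.

Theorem theorem1p2 (E : finType) (M : matroid E) (k : fieldType) :
  (forall F : {set E}, flat M F ->
    [/\ forall (i : int) (v : standardk k M F), i < 0 ->
          v \in standardk_grade k M F i -> v = 0,
        has_graded_dim (standardk_grade k M F)
          (\sum_(G : {set E} | flat M G && (F \subset G))
             (mobius_plus M F G)%:~R * tvar ^+ (rank M G - rank M F))
      & \sum_(G : {set E} | flat M G && (F \subset G))
             (mobius_plus M F G)%:~R * tvar ^+ (rank M G - rank M F) =
        (- tvar) ^+ contraction_rank M F *
        eval_ratfun (contraction_charpoly M F) (- tvar^-1)]) /\
  has_graded_dim (Sk_grade k M)
    (\sum_(F : {set E} | flat M F)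
       eval_ratfun (contraction_charpoly M F) (- tvar) *
       eval_ratfun (contraction_charpoly M F) (- tvar^-1)).
Proof.
split=> [F fF|]; last by rewrite -sum_S_index; apply: S_graded_dim.
split; first by move=> i v; apply: standardk_grade_lt0.
- by rewrite -sum_standard_flags //; apply: standard_graded_dim.
exact: sum_mobius_plus tvar_neq0.
Qed.
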